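(* Let $R$ be a commutative unital ring, $\mathcal{A}$ a commutative unital $R$-algebra, and $(\mathcal{M},a)$ an anchored $\mathcal{A}$-module. Let $(\mathrm{FS}\mathcal{M},[-,-]^{\widetilde{\ }}_{\mathrm{Lei}},(\mathrm{F}a)^{\widetilde{\ }})$, with anchored module map $\tilde\imath:\mathcal{M}\to\mathrm{FS}\mathcal{M}$, be the free symmetric Leibniz pseudoalgebra over $(\mathcal{M},a)$. The free Courant algebroid over $(\mathcal{M},a)$ is the generalized Courant pseudoalgebra $$\mathcal{C}(\mathrm{FS}\mathcal{M})=(\mathrm{FS}\mathcal{M},\mathcal{R}(\mathrm{FS}\mathcal{M}),[-,-]^{\widetilde{\ }}_{\mathrm{Lei}},(-|-),(\mathrm{F}a)^{\widetilde{\ }},\tilde\mu^\ell,\tilde\mu^r)$$ associated to the symmetric Leibniz pseudoalgebra $\mathrm{FS}\mathcal{M}$, together with the anchored module map $\tilde\imath:\mathcal{M}\to\mathrm{FS}\mathcal{M}$. More precisely, for any generalized Courant pseudoalgebra $$\mathcal{C}=(\mathcal{E}_1,\mathcal{E}_2,[-,-]',(-|-)',a',\mu'^\ell,\mu'^r)$$ over $(R,\mathcal{A})$ and any anchored module map $\phi:\mathcal{M}\to\mathcal{E}_1$, there exists a unique morphism of generalized Courant pseudoalgebras $(\phi_1,\phi_2)$ from $\mathcal{C}(\mathrm{FS}\mathcal{M})$ to $\mathcal{C}$ such that $\phi_1\,\tilde\imath=\phi$.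
   Context: $\mathrm{Der}\,\mathcal{A}$ is the $\mathcal{A}$-module of ($R$-linear) derivations of $\mathcal{A}$, with the commutator bracket. An anchored module over $\mathcal{A}$ is an $\mathcal{A}$-module $\mathcal{E}$ with an $\mathcal{A}$-linear map $a:\mathcal{E}\to\mathrm{Der}\,\mathcal{A}$; a morphism (map) of anchored modules $(\mathcal{E}_1,a_1)\to(\mathcal{E}_2,a_2)$ is an $\mathcal{A}$-linear map $\phi$ with $a_2\phi=a_1$. A (left) Leibniz bracket on an $R$-module is an $R$-bilinear bracket with $[X,[Y,Z]]=[[X,Y],Z]+[Y,[X,Z]]$; it makes the $R$-module a Leibniz $R$-algebra. The symmetrized bracket is $X\circ Y:=[X,Y]+[Y,X]$. Leibniz pseudoalgebras. A Leibniz pseudoalgebra over $(R,\mathcal{A})$ is an anchored module $(\mathcal{E},a)$ over $\mathcal{A}$ with a Leibniz $R$-algebra structure $[-,-]$ such that, for all $f\in\mathcal{A}$, $X,Y\in\mathcal{E}$: $[X,fY]=f[X,Y]+a(X)(f)Y$ and $a[X,Y]=[a(X),a(Y)]$. A morphism of Leibniz pseudoalgebras over $(R,\mathcal{A})$ is an $\mathcal{A}$-linear map that intertwines anchors ($a_2\phi=a_1$) and brackets. A Leibniz pseudoalgebra is symmetric if, for all $f\in\mathcal{A}$, $X,Y,Z\in\mathcal{E}$: $X\circ fY-(fX)\circ Y=0$ and $[fX,Y\circ Z]-[X,Y]\circ fZ-(fY)\circ[X,Z]=0$. Modules. A module over a Leibniz $R$-algebra $(V,[-,-])$ is an $R$-module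 $W$ with $\mu^\ell\in\mathrm{Hom}_R(V\otimes_R W,W)$, $\mu^r\in\mathrm{Hom}_R(W\otimes_R V,W)$ such that for all $x,y\in V$: $\mu^r[x,y]=\mu^r(y)\mu^r(x)+\mu^\ell(x)\mu^r(y)$, $\mu^r[x,y]=\mu^\ell(x)\mu^r(y)-\mu^r(y)\mu^\ell(x)$, $\mu^\ell[x,y]=\mu^\ell(x)\mu^\ell(y)-\mu^\ell(y)\mu^\ell(x)$. A module over a Leibniz pseudoalgebra $(\mathcal{E}_1,[-,-],a)$ (an $\mathcal{E}_1$-module) is an $\mathcal{A}$-module $\mathcal{E}_2$ that is a module $(\mu^\ell,\mu^r)$ over the Leibniz $R$-algebra $\mathcal{E}_1$ with $\mu^\ell(X)(fY)=f\mu^\ell(X)(Y)+a(X)(f)Y$ for $f\in\mathcal{A}$, $X\in\mathcal{E}_1$, $Y\in\mathcal{E}_2$. A morphism from an $\mathcal{E}_1$-module $(\mathcal{E}_2,\mu^\ell,\mu^r)$ to an $\mathcal{E}_1'$-module $(\mathcal{E}_2',\mu'^\ell,\mu'^r)$ is a pair $(\phi_1,\phi_2)$ with $\phi_1:\mathcal{E}_1\to\mathcal{E}_1'$ a Leibniz pseudoalgebra morphism and $\phi_2:\mathcal{E}_2\to\mathcal{E}_2'$ an $\mathcal{A}$-linear map such that $\mu'^\ell(\phi_1\times\phi_2)=\phi_2\mu^\ell$ and $\mu'^r(\phi_2\times\phi_1)=\phi_2\mu^r$. Generalized Courant pseudoalgebras. A generalized pre-Courant pseudoalgebra over $(R,\mathcal{A})$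 is a tuple $(\mathcal{E}_1,\mathcal{E}_2,[-,-],(-|-),a,\mu^\ell,\mu^r)$, where $(\mathcal{E}_1,[-,-],a)$ is a Leibniz pseudoalgebra, $(\mathcal{E}_2,\mu^\ell,\mu^r)$ is an $\mathcal{E}_1$-module, and $(-|-):\mathcal{E}_1\times\mathcal{E}_1\to\mathcal{E}_2$ is symmetric $\mathcal{A}$-bilinear with, for all $X,Y,Z\in\mathcal{E}_1$: $\mu^\ell(X)(Y|Z)=([X,Y]|Z)+(Y|[X,Z])$; $-\mu^r(X)(Y|Z)=([Y,Z]+[Z,Y]|X)$; $([X,Y]|Z)+(Y|[X,Z])=([Y,Z]+[Z,Y]|X)$. It is a generalized Courant pseudoalgebra if moreover the Leibniz pseudoalgebra $(\mathcal{E}_1,[-,-],a)$ is symmetric. A morphism of generalized (pre-)Courant pseudoalgebras over $(R,\mathcal{A})$ is a morphism $(\phi_1,\phi_2)$ from the $\mathcal{E}_1$-module $\mathcal{E}_2$ to the $\mathcal{E}'_1$-module $\mathcal{E}'_2$ with $(-|-)'(\phi_1\times\phi_1)=\phi_2(-|-)$. The generalized Courant pseudoalgebra $\mathcal{C}(\mathcal{E})$ associated to a symmetric Leibniz pseudoalgebra $(\mathcal{E},[-,-],a)$. With $\odot$ the symmetric tensor product over $\mathcal{A}$, put $\mathcal{R}(\mathcal{E})=\mathcal{E}^{\odot2}/\langle\mathrm{Inv}\rangle$, where $\langle\mathrm{Inv}\rangle$ is the $\mathcal{A}$-submodule generated by all $[X,Y]\odot Z+Y\odot[X,Z]-X\odot([Y,Z]+[Z,Y])$,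 $X,Y,Z\in\mathcal{E}$. The actions $\tilde\mu^\ell,\tilde\mu^r$ of $\mathcal{E}$ on $\mathcal{R}(\mathcal{E})$ are induced by $\mu^\ell(X)(Y_1\odot Y_2)=[X,Y_1]\odot Y_2+Y_1\odot[X,Y_2]$ and $\mu^r(X)(Y_1\odot Y_2)=-(Y_1\circ Y_2)\odot X$, and $(X|Y)$ is the class of $X\odot Y$ in $\mathcal{R}(\mathcal{E})$. Then $\mathcal{C}(\mathcal{E})=(\mathcal{E},\mathcal{R}(\mathcal{E}),[-,-],(-|-),a,\tilde\mu^\ell,\tilde\mu^r)$ is a generalized Courant pseudoalgebra. The free symmetric Leibniz pseudoalgebra $\mathrm{FS}\mathcal{M}$. Let $\mathrm{F}\mathcal{M}=\overline{T}\mathcal{M}=\bigoplus_{k\ge1}\mathcal{M}^{\otimes_R k}$ with the $\mathcal{A}$-module structure extending that of $\mathcal{M}$ and defined inductively by $f(m_1\otimes\cdots\otimes m_n):=m_1\otimes f(m_2\otimes\cdots\otimes m_n)-a(m_1)(f)(m_2\otimes\cdots\otimes m_n)$ for $n\ge 2$. Let $[-,-]_{\mathrm{Lei}}$ be the universal Leibniz bracket, determined by $m_1\otimes\cdots\otimes m_k=[m_1,[m_2,\ldots,[m_{k-1},m_k]\ldots]]$, and let $\mathrm{F}a:\overline{T}\mathcal{M}\to\mathrm{Der}\,\mathcal{A}$ be the unique Leibniz $R$-algebra morphism extending $a$. Then $\mathrm{FS}\mathcal{M}$ is the quotient of $\mathrm{F}\mathcal{M}$ by the $\mathcal{A}$-submodule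 generated by all $X\circ fY-(fX)\circ Y$ and all $[fX,Y\circ Z]_{\mathrm{Lei}}-[X,Y]_{\mathrm{Lei}}\circ fZ-(fY)\circ[X,Z]_{\mathrm{Lei}}$ ($f\in\mathcal{A}$, $X,Y,Z\in\mathrm{F}\mathcal{M}$), with induced bracket $[-,-]^{\widetilde{\ }}_{\mathrm{Lei}}$, induced anchor $(\mathrm{F}a)^{\widetilde{\ }}$, and $\tilde\imath(m)$ the class of $m\in\mathcal{M}$. It is free: for every symmetric Leibniz pseudoalgebra $\mathcal{E}$ over $(R,\mathcal{A})$ and every anchored module map $\phi:\mathcal{M}\to\mathcal{E}$ there is a unique Leibniz pseudoalgebra morphism $\Phi:\mathrm{FS}\mathcal{M}\to\mathcal{E}$ with $\Phi\,\tilde\imath=\phi$. *)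

(* Defs.v *)
From HB Require Import structures.
From mathcomp Require Import all_boot all_algebra ring.
From mathcomp Require Import boolp functions.
From mathcomp.multinomials Require Import freeg.

Set Implicit Arguments.
Unset Strict Implicit.
Unset Printing Implicit Defensive.

Import GRing.Theory.
Local Open Scope ring_scope.
Local Open Scope quotient_scope.

Inductive zspan (V : zmodType) (S : V -> Prop) : V -> Prop :=
| zspan0 : zspan S 0
| zspan_gen x : S x -> zspan S x
| zspanB x y : zspan S x -> zspan S y -> zspan S (x - y).

Definition zspanb (V : zmodType) (S : V -> Prop) : V -> bool :=
  fun x => `[< zspan S x >].

Lemma zspanb_zmod_closed (V : zmodType) (S : V -> Prop) :
  zmod_closed (zspanb S).
Proof.
split; first exact/asboolP/zspan0.
by move=> x y /asboolP Sx /asboolP Sy; apply/asboolP/zspanB.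
Qed.

HB.instance Definition _ (V : zmodType) (S : V -> Prop) :=
  GRing.isZmodClosed.Build V (zspanb S) (zspanb_zmod_closed S).

Definition zspan_closed (V : zmodType) (S : V -> Prop) : zmodClosed V :=
  GRing.ZmodClosed.clone V (zspanb S) _.

Definition zquot (V : zmodType) (S : V -> Prop) : Type := Quotient.quot (zspan_closed S).
HB.instance Definition _ (V : zmodType) (S : V -> Prop) :=
  GRing.Zmodule.on (zquot S).

Definition zq (V : zmodType) (S : V -> Prop) (x : V) : zquot S :=
  \pi_(Quotient.quot (zspan_closed S)) x.

Definition zquot_lift (V : zmodType) (S : V -> Prop) (T : Type) (h : V -> T)
  (q : zquot S) : T := h (repr (q : Quotient.quot (zspan_closed S))).

Inductive lspan (K : pzRingType) (V : lmodType K) (S : V -> Prop) : V -> Prop :=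
| lspan0 : lspan S 0
| lspan_lin k x y : S x -> lspan S y -> lspan S (k *: x + y).

Section ZQuot.
Context (V : zmodType) (S : V -> Prop).

Lemma zq_additive : zmod_morphism (@zq V S).
Proof. by move=> x y; exact: (raddfB (\pi_(Quotient.quot (zspan_closed S)))). Qed.
HB.instance Definition _ :=
  GRing.isZmodMorphism.Build V (zquot S) (@zq V S) zq_additive.

Lemma zqP x y : zspan S (x - y) <-> zq S x = zq S y.
Proof.
rewrite /zq; split.
  by move=> h; apply/eqP; rewrite -Quotient.idealrBE; apply/asboolP.
by move=> /eqP; rewrite -Quotient.idealrBE => /asboolP.
Qed.

Lemma zq_ind (P : zquot S -> Prop) : (forall x, P (zq S x)) -> forall q, P q.
Proof. by move=> h q; have := h (repr q); rewrite /zq reprK. Qed.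

Lemma zquot_liftE (W : zmodType) (h : V -> W) :
  zmod_morphism h -> (forall x, S x -> h x = 0) ->
  forall x, zquot_lift h (zq S x) = h x.
Proof.
move=> hB hS x; apply/eqP; rewrite -subr_eq0 -hB; apply/eqP.
have h0 : h 0 = 0 by rewrite -(subrr 0) hB subrr.
have key y : zspan S y -> h y = 0.
  by elim=> [//|//|a b _ ha _ hb]; rewrite hB ha hb subr0.
by apply/key/zqP; rewrite /zq reprK.
Qed.
End ZQuot.

Section LQuot.
Context (K : pzRingType) (V : lmodType K) (S : V -> Prop).
Local Notation N := (lspan S).

Lemma lspanD x y : N x -> N y -> N (x + y).
Proof. by elim=> [|k s z Ss _ ih] Ny; rewrite ?add0r// -addrA; apply: lspan_lin => //; apply: ih. Qed.
Lemma lspanZ k x : N x -> N (k *: x).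
Proof.
elim=> [|k' s y Ss _ ih]; first by rewrite scaler0; exact: lspan0.
by rewrite scalerDr scalerA; apply: lspan_lin.
Qed.
Lemma lspanN x : N x -> N (- x).
Proof. by rewrite -scaleN1r; apply: lspanZ. Qed.
Lemma lspan_gen x : S x -> N x.
Proof. by move=> Sx; rewrite -(scale1r x) -(addr0 (1 *: x)); apply: lspan_lin => //; exact: lspan0. Qed.

Lemma zspan_lspan x : zspan N x -> N x.
Proof. by elim=> [|//|y z _ Ny _ Nz]; [exact: lspan0|apply: lspanD => //; apply: lspanN]. Qed.

Definition lquot : Type := zquot N.
HB.instance Definition _ := GRing.Zmodule.on lquot.

Definition lq (x : V) : lquot := zq N x.
Fact lq_additive : zmod_morphism lq. Proof. exact: zq_additive. Qed.
HB.instance Definition _ := GRing.isZmodMorphism.Build V lquot lq lq_additive.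

Lemma lqP x y : N (x - y) <-> lq x = lq y.
Proof. by rewrite -zqP; split; [exact: zspan_gen|exact: zspan_lspan]. Qed.
Lemma lq_eq0 x : N x <-> lq x = 0.
Proof. by rewrite -(raddf0 lq) -lqP subr0. Qed.
Lemma lq_ind (P : lquot -> Prop) : (forall x, P (lq x)) -> forall q, P q.
Proof. exact: zq_ind. Qed.

Definition lquot_lift (T : Type) (h : V -> T) (q : lquot) : T := zquot_lift h q.

Lemma lquot_liftE (W : zmodType) (h : V -> W) :
  zmod_morphism h -> (forall x, N x -> h x = 0) ->
  forall x, lquot_lift h (lq x) = h x.
Proof. exact: zquot_liftE. Qed.

Definition lq_scale (k : K) : lquot -> lquot := lquot_lift (fun x => lq (k *: x)).
Lemma lq_scaleE k x : lq_scale k (lq x) = lq (k *: x).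
Proof.
apply: lquot_liftE => [y z|y Ny]; first by rewrite scalerBr raddfB.
by apply/lq_eq0/lspanZ.
Qed.
Fact lq_scaleA a b v : lq_scale a (lq_scale b v) = lq_scale (a * b) v.
Proof. by elim/lq_ind: v => x; rewrite !lq_scaleE scalerA. Qed.
Fact lq_scale1 : left_id 1 lq_scale.
Proof. by elim/lq_ind => x; rewrite lq_scaleE scale1r. Qed.
Fact lq_scaleDr : right_distributive lq_scale +%R.
Proof.
move=> a; elim/lq_ind => x; elim/lq_ind => y.
by rewrite !lq_scaleE -!raddfD /= !lq_scaleE scalerDr.
Qed.
Fact lq_scaleDl v : {morph lq_scale^~ v : a b / a + b}.
Proof. by elim/lq_ind: v => x a b; rewrite !lq_scaleE scalerDl raddfD. Qed.
HB.instance Definition _ := GRing.Zmodule_isLmodule.Build K lquot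
  lq_scaleA lq_scale1 lq_scaleDr lq_scaleDl.

Lemma lqZ k x : lq (k *: x) = k *: lq x.
Proof. by rewrite -lq_scaleE. Qed.
End LQuot.

Section Tensor.
Context (K : comPzRingType) (V W : lmodType K).

Inductive tens_rel : {freeg (V * W)%type / int} -> Prop :=
| tens_relDl v v' w :
    tens_rel (<< (v + v', w) >> - << (v, w) >> - << (v', w) >>)
| tens_relDr v w w' :
    tens_rel (<< (v, w + w') >> - << (v, w) >> - << (v, w') >>)
| tens_relZ k v w : tens_rel (<< (k *: v, w) >> - << (v, k *: w) >>).

(* The quotient of the free abelian group on [V * W]. *)
Definition tensor : Type := zquot tens_rel.
HB.instance Definition _ := GRing.Zmodule.on tensor.

Definition tens (v : V) (w : W) : tensor := zq tens_rel << (v, w) >>.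

(* Only meaningful when [h] is balanced; see [tens_liftE]. *)
Definition tens_lift (Z : zmodType) (h : V -> W -> Z) : tensor -> Z :=
  zquot_lift (fglift (fun p : V * W => h p.1 p.2 : zmodule Z)).

Definition balanced (Z : zmodType) (h : V -> W -> Z) :=
  [/\ forall v v' w, h (v + v') w = h v w + h v' w,
      forall v w w', h v (w + w') = h v w + h v w' &
      forall k v w, h (k *: v) w = h v (k *: w)].

Lemma tensDl v v' w : tens (v + v') w = tens v w + tens v' w.
Proof.
rewrite /tens -raddfD; apply/zqP/zspan_gen.
by rewrite opprD addrA; exact: tens_relDl.
Qed.
Lemma tensDr v w w' : tens v (w + w') = tens v w + tens v w'.
Proof.
rewrite /tens -raddfD; apply/zqP/zspan_gen.
by rewrite opprD addrA; exact: tens_relDr.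
Qed.
Lemma tens_bal k v w : tens (k *: v) w = tens v (k *: w).
Proof. by apply/zqP/zspan_gen/tens_relZ. Qed.

Let tensr w v := tens v w.
Let tensr_additive w : zmod_morphism (tensr w).
Proof. by move=> a b; apply: (addIr (tens b w)); rewrite /tensr -tensDl !subrK. Qed.
HB.instance Definition _ w :=
  GRing.isZmodMorphism.Build V tensor (tensr w) (tensr_additive w).

Lemma tens_ind (P : tensor -> Prop) : P 0 ->
  (forall x y, P x -> P y -> P (x + y)) -> (forall v w, P (tens v w)) ->
  forall x, P x.
Proof.
move=> P0 PD Pt; elim/zq_ind => D; rewrite -(freeg_sumE D) raddf_sum /=.
elim/big_ind: _ => // -[v w] _; set k := coeff _ _.
have -> : << k *g (v, w) >> = << (v, w) >> *~ k.
  by rewrite freegU_mulz intz.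
rewrite raddfMz /=; change (P (tensr w v *~ k)).
by rewrite -raddfMz; exact: Pt.
Qed.

Section Lift.
Context (Z : zmodType) (h : V -> W -> Z).
Context (hP : balanced h).

Lemma tens_liftE v w : tens_lift h (tens v w) = h v w.
Proof.
case: hP => hl hr hk.
rewrite /tens_lift zquot_liftE; last 2 first.
- exact: lift_is_additive.
- pose L := fglift (fun p : V * W => h p.1 p.2 : zmodule Z).
  have LB : zmod_morphism L by exact: lift_is_additive.
  have L1 p : L << p >> = h p.1 p.2 by rewrite /L liftU scale1r.
  rewrite -/L => _ [a a' b|a b b'|k a b]; rewrite !LB !L1 /=.
  + by rewrite hl addrAC addrK subrr.
  + by rewrite hr addrAC addrK subrr.
  + by rewrite hk subrr.
by rewrite liftU scale1r.
Qed.

Lemma tens_lift_additive : zmod_morphism (tens_lift h).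
Proof.
case: hP => hl hr hk.
pose L := fglift (fun p : V * W => h p.1 p.2 : zmodule Z).
have LB : zmod_morphism L by exact: lift_is_additive.
have L1 p : L << p >> = h p.1 p.2 by rewrite /L liftU scale1r.
have LR x : tens_rel x -> L x = 0.
  case=> [a a' b|a b b'|k a b]; rewrite !LB !L1 /=.
  + by rewrite hl addrAC addrK subrr.
  + by rewrite hr addrAC addrK subrr.
  + by rewrite hk subrr.
have E x : tens_lift h (zq _ x) = L x by exact: zquot_liftE.
by elim/zq_ind => x; elim/zq_ind => y; rewrite -raddfB !E LB.
Qed.
End Lift.
End Tensor.

Lemma morphD_zmod (U V : zmodType) (h : U -> V) :
  {morph h : x y / x + y} -> zmod_morphism h.
Proof. by move=> hD x y; apply: (addIr (h y)); rewrite -hD !subrK. Qed.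

Lemma zmod_morph0 (U V : zmodType) (h : U -> V) : zmod_morphism h -> h 0 = 0.
Proof. by move=> hB; rewrite -(subrr 0) hB subrr. Qed.

Lemma zmod_morphD (U V : zmodType) (h : U -> V) :
  zmod_morphism h -> {morph h : x y / x + y}.
Proof.
move=> hB x y; have h0 : h 0 = 0 by rewrite -(subrr 0) hB subrr.
have hN z : h (- z) = - h z by rewrite -(sub0r z) hB h0 sub0r.
by rewrite -{1}(opprK y) hB hN opprK.
Qed.

Section TensorModule.
Context (K : comPzRingType) (V W : lmodType K).
Local Notation T := (tensor V W).

Definition tens_scale (k : K) : T -> T := tens_lift (fun v w => tens (k *: v) w).
Fact tens_scale_bal k : balanced (fun (v : V) (w : W) => tens (k *: v) w).
Proof.
split=> [v v' w|v w w'|c v w]; first by rewrite scalerDr tensDl.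
  by rewrite tensDr.
by rewrite -tens_bal !scalerA mulrC.
Qed.
Lemma tens_scaleE k v w : tens_scale k (tens v w) = tens (k *: v) w.
Proof. exact: tens_liftE (tens_scale_bal k) _ _. Qed.
Fact tens_scaleDr : right_distributive tens_scale +%R.
Proof. by move=> k; apply/zmod_morphD/tens_lift_additive/tens_scale_bal. Qed.
Let tens_scale0 k : tens_scale k 0 = 0.
Proof. by apply: (addIr (tens_scale k 0)); rewrite -tens_scaleDr !add0r. Qed.
Fact tens_scaleA a b v : tens_scale a (tens_scale b v) = tens_scale (a * b) v.
Proof.
elim/tens_ind: v => [|x y hx hy|v w]; first by rewrite !tens_scale0.
  by rewrite !tens_scaleDr hx hy.
by rewrite !tens_scaleE scalerA.
Qed.
Fact tens_scale1 : left_id 1 tens_scale.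
Proof.
elim/tens_ind => [|x y hx hy|v w]; first by rewrite !tens_scale0.
  by rewrite tens_scaleDr hx hy.
by rewrite tens_scaleE scale1r.
Qed.
Fact tens_scaleDl v : {morph tens_scale^~ v : a b / a + b}.
Proof.
move=> a b; elim/tens_ind: v => [|x y hx hy|v w].
- by rewrite !tens_scale0 addr0.
- by rewrite !tens_scaleDr hx hy addrACA.
by rewrite !tens_scaleE scalerDl tensDl.
Qed.
HB.instance Definition _ := GRing.Zmodule_isLmodule.Build K (tensor V W)
  tens_scaleA tens_scale1 tens_scaleDr tens_scaleDl.

Lemma tensZl k v w : tens (k *: v) w = k *: tens v w :> tensor V W.
Proof. by rewrite -tens_scaleE. Qed.
Lemma tensZr k v w : tens v (k *: w) = k *: tens v w :> tensor V W.
Proof. by rewrite -tens_bal tensZl. Qed.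
End TensorModule.

Section DirectSum.
Context (K : pzRingType) (V : nat -> lmodType K).

Record dsum := DSum {
  dsum_val :> forall k, V k;
  dsum_fin : exists n, forall k, (n <= k)%N -> dsum_val k = 0 }.

Lemma dsum_eq (x y : dsum) : (forall k, x k = y k) -> x = y.
Proof.
case: x y => [x hx] [y hy] /= e.
have {}e : x = y by exact: functional_extensionality_dep.
by rewrite e in hx *; congr DSum; exact: Prop_irrelevance.
Qed.

HB.instance Definition _ := gen_eqMixin dsum.
HB.instance Definition _ := gen_choiceMixin dsum.

Definition dsum0 : dsum.
Proof. by exists (fun=> 0); exists 0%N. Defined.
Definition dsum_add (x y : dsum) : dsum.
Proof.
exists (fun k => x k + y k); have [n hn] := dsum_fin x; have [m hm] := dsum_fin y.
by exists (maxn n m) => k; rewrite geq_max => /andP[/hn -> /hm ->]; rewrite addr0.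
Defined.
Definition dsum_opp (x : dsum) : dsum.
Proof.
by exists (fun k => - x k); have [n hn] := dsum_fin x; exists n => k /hn ->; rewrite oppr0.
Defined.
Definition dsum_scale (a : K) (x : dsum) : dsum.
Proof.
by exists (fun k => a *: x k); have [n hn] := dsum_fin x; exists n => k /hn ->; rewrite scaler0.
Defined.

Fact dsum_addA : associative dsum_add.
Proof. by move=> x y z; apply: dsum_eq => k /=; rewrite addrA. Qed.
Fact dsum_addC : commutative dsum_add.
Proof. by move=> x y; apply: dsum_eq => k /=; rewrite addrC. Qed.
Fact dsum_add0 : left_id dsum0 dsum_add.
Proof. by move=> x; apply: dsum_eq => k /=; rewrite add0r. Qed.
Fact dsum_addN : left_inverse dsum0 dsum_opp dsum_add.
Proof. by move=> x; apply: dsum_eq => k /=; rewrite addNr. Qed.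
HB.instance Definition _ := GRing.isZmodule.Build dsum
  dsum_addA dsum_addC dsum_add0 dsum_addN.
Fact dsum_scaleA a b v : dsum_scale a (dsum_scale b v) = dsum_scale (a * b) v.
Proof. by apply: dsum_eq => k /=; rewrite scalerA. Qed.
Fact dsum_scale1 : left_id 1 dsum_scale.
Proof. by move=> x; apply: dsum_eq => k /=; rewrite scale1r. Qed.
Fact dsum_scaleDr : right_distributive dsum_scale +%R.
Proof. by move=> a x y; apply: dsum_eq => k /=; rewrite scalerDr. Qed.
Fact dsum_scaleDl v : {morph dsum_scale^~ v : a b / a + b}.
Proof. by move=> a b; apply: dsum_eq => k /=; rewrite scalerDl. Qed.
HB.instance Definition _ := GRing.Zmodule_isLmodule.Build K dsum
  dsum_scaleA dsum_scale1 dsum_scaleDr dsum_scaleDl.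

Lemma dsum_addE (x y : dsum) k : (x + y) k = x k + y k. Proof. by []. Qed.
Lemma dsum_scaleE a (x : dsum) k : (a *: x) k = a *: x k. Proof. by []. Qed.

Definition dsum_in_val n (v : V n) k : V k :=
  if eqP is ReflectT e in reflect _ b return V k then ecast i (V i) e v else 0.

Lemma dsum_in_val_id n (v : V n) : dsum_in_val v n = v.
Proof. by rewrite /dsum_in_val; case: eqP => // e; rewrite eq_axiomK. Qed.
Lemma dsum_in_val_neq n (v : V n) k : n <> k -> dsum_in_val v k = 0.
Proof. by rewrite /dsum_in_val; case: eqP => // e. Qed.

Definition dsum_in n (v : V n) : dsum.
Proof.
exists (dsum_in_val v); exists n.+1 => k lt_nk.
by apply: dsum_in_val_neq => e; rewrite e ltnn in lt_nk.
Defined.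

Lemma dsum_in_linear n : linear (@dsum_in n).
Proof.
move=> a x y; apply: dsum_eq => k; rewrite dsum_addE dsum_scaleE /=.
have [e|/eqP ne] := eqVneq n k; first by case: _ / e; rewrite !dsum_in_val_id.
by rewrite !dsum_in_val_neq // scaler0 addr0.
Qed.
HB.instance Definition _ n :=
  GRing.isLinear.Build K (V n) dsum *:%R (@dsum_in n) (@dsum_in_linear n).

Definition dsum_lift (Z : zmodType) (g : forall k, V k -> Z) (x : dsum) : Z :=
  \sum_(k < sval (cid (dsum_fin x))) g k (x k).

Lemma dsum_liftE (Z : zmodType) (g : forall k, V k -> Z) (x : dsum) n :
  (forall k, zmod_morphism (g k)) -> (forall k, (n <= k)%N -> x k = 0) ->
  dsum_lift g x = \sum_(k < n) g k (x k).
Proof.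
move=> gB hn; rewrite /dsum_lift; case: cid => m hm /=.
have g0 k : g k 0 = 0 by exact: zmod_morph0.
wlog le_mn : m n hm hn / (m <= n)%N => [W|].
  by have [/W->//|/ltnW/W->//] := leqP m n.
rewrite (big_ord_widen n (fun k => g k (x k)) le_mn) big_mkcond.
by apply: eq_bigr => k _; case: ltnP => // /hm ->; rewrite g0.
Qed.

Lemma dsum_lift_additive (Z : zmodType) (g : forall k, V k -> Z) :
  (forall k, zmod_morphism (g k)) -> zmod_morphism (dsum_lift g).
Proof.
move=> gB; apply: morphD_zmod => x y.
have [n hn] := dsum_fin x; have [m hm] := dsum_fin y.
rewrite !(@dsum_liftE _ g _ (maxn n m)) // => [|k|k|k]; last 3 first.
- by rewrite geq_max => /andP[_ /hm].
- by rewrite geq_max => /andP[/hn].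
- by rewrite dsum_addE geq_max => /andP[/hn -> /hm ->]; rewrite addr0.
by rewrite -big_split; apply: eq_bigr => k _; exact: (zmod_morphD (gB k)).
Qed.

Lemma dsum_lift_in (Z : zmodType) (g : forall k, V k -> Z) n (v : V n) :
  (forall k, zmod_morphism (g k)) -> dsum_lift g (dsum_in v) = g n v.
Proof.
move=> gB; have g0 k : g k 0 = 0 by exact: zmod_morph0.
rewrite (@dsum_liftE _ g _ n.+1) => [||k lt_nk] //=; last first.
  by apply: dsum_in_val_neq => e; rewrite e ltnn in lt_nk.
rewrite big_ord_recr /= dsum_in_val_id big1 ?add0r // => k _.
by rewrite dsum_in_val_neq // => e; have := ltn_ord k; rewrite -e ltnn.
Qed.

Lemma dsum_ind (P : dsum -> Prop) : P 0 ->
  (forall x y, P x -> P y -> P (x + y)) -> (forall n v, P (@dsum_in n v)) ->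
  forall x, P x.
Proof.
move=> P0 PD Pi x; have [n hn] := dsum_fin x.
have -> : x = \sum_(k < n) dsum_in (x k); last by elim/big_ind: _.
apply: dsum_eq => k.
have ev (r : seq 'I_n) : (\sum_(i <- r) dsum_in (x i)) k = \sum_(i <- r) dsum_in_val (x i) k.
  by elim/big_rec2: _ => // i _ y _ <-.
rewrite ev; case: (ltnP k n) => [lt_kn|/[dup] le_nk /hn ->]; last first.
  rewrite big1 // => i _; apply: dsum_in_val_neq => e.
  by have := ltn_ord i; rewrite e ltnNge le_nk.
rewrite (bigD1 (Ordinal lt_kn)) //= dsum_in_val_id big1 ?addr0 // => i ne.
by apply: dsum_in_val_neq => e; case/eqP: ne; apply/val_inj.
Qed.
End DirectSum.

(* The [R]-module underlying a module over an [R]-algebra [A].  The algebra is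
   given by its structure morphism [eta] rather than by a [comAlgType], which
   would exclude the zero ring. *)
Definition restr (R A : comPzRingType) (eta : {rmorphism R -> A})
  (V : lmodType A) : Type := V.

Section Restr.
Context (R A : comPzRingType) (eta : {rmorphism R -> A}) (V : lmodType A).
Local Notation rV := (restr eta V).
HB.instance Definition _ := GRing.Zmodule.on rV.
Definition restr_scale (r : R) (v : rV) : rV := eta r *: (v : V).
Fact restr_scaleA a b v : restr_scale a (restr_scale b v) = restr_scale (a * b) v.
Proof. by rewrite /restr_scale scalerA rmorphM. Qed.
Fact restr_scale1 : left_id 1 restr_scale.
Proof. by move=> v; rewrite /restr_scale rmorph1 scale1r. Qed.
Fact restr_scaleDr : right_distributive restr_scale +%R.
Proof. by move=> a u v; exact: scalerDr. Qed.
Fact restr_scaleDl v : {morph restr_scale^~ v : a b / a + b}.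
Proof. by move=> a b; rewrite /restr_scale rmorphD scalerDl. Qed.
HB.instance Definition _ := GRing.Zmodule_isLmodule.Build R rV
  restr_scaleA restr_scale1 restr_scaleDr restr_scaleDl.
Lemma restrZ r (v : rV) : r *: v = eta r *: (v : V). Proof. by []. Qed.
End Restr.

(* The square-zero extension of [K] by [V]: identities between vectors become
   ring identities, which the [ring] tactic decides. *)
Section SquareZero.
Context (K : comPzRingType) (V : lmodType K).
Definition sqz : Type := (K * V)%type.
HB.instance Definition _ := GRing.Zmodule.on sqz.
Definition sqz_one : sqz := (1, 0).
Definition sqz_mul (x y : sqz) : sqz := (x.1 * y.1, x.1 *: y.2 + y.1 *: x.2).
Fact sqz_mulA : associative sqz_mul.
Proof.
move=> [a x] [b y] [c z]; congr pair => /=; first by rewrite mulrA.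
by rewrite !scalerDr !scalerA -addrA [c * a]mulrC [c * b]mulrC.
Qed.
Fact sqz_mulC : commutative sqz_mul.
Proof. by move=> [a x] [b y]; congr pair => /=; [rewrite mulrC|rewrite addrC]. Qed.
Fact sqz_mul1 : left_id sqz_one sqz_mul.
Proof. by move=> [a x]; congr pair => /=; [rewrite mul1r|rewrite scale1r scaler0 addr0]. Qed.
Fact sqz_mulDl : left_distributive sqz_mul +%R.
Proof.
move=> [a x] [b y] [c z]; congr pair => /=; first by rewrite mulrDl.
by rewrite scalerDl scalerDr addrACA.
Qed.
HB.instance Definition _ := GRing.Zmodule_isComPzRing.Build sqz
  sqz_mulA sqz_mulC sqz_mul1 sqz_mulDl.

Definition sqz_vec (v : V) : sqz := (0, v).
Definition sqz_sc (k : K) : sqz := (k, 0).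
Lemma sqz_vec_inj : injective sqz_vec. Proof. by move=> x y []. Qed.
Lemma sqz_vecD x y : sqz_vec (x + y) = sqz_vec x + sqz_vec y.
Proof. by congr pair; rewrite /= ?addr0. Qed.
Lemma sqz_vecN x : sqz_vec (- x) = - sqz_vec x.
Proof. by congr pair; rewrite /= ?oppr0. Qed.
Lemma sqz_vec0 : sqz_vec 0 = 0. Proof. by []. Qed.
Lemma sqz_vecZ k x : sqz_vec (k *: x) = sqz_sc k * sqz_vec x.
Proof. by congr pair; rewrite /= ?mulr0 ?scale0r ?addr0. Qed.
Lemma sqz_scD j k : sqz_sc (j + k) = sqz_sc j + sqz_sc k.
Proof. by congr pair; rewrite /= ?addr0. Qed.
Lemma sqz_scN k : sqz_sc (- k) = - sqz_sc k.
Proof. by congr pair; rewrite /= ?oppr0. Qed.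
Lemma sqz_scM j k : sqz_sc (j * k) = sqz_sc j * sqz_sc k.
Proof. by congr pair; rewrite /= ?scaler0 ?addr0. Qed.
Lemma sqz_sc1 : sqz_sc 1 = 1. Proof. by []. Qed.
Lemma sqz_sc0 : sqz_sc 0 = 0. Proof. by []. Qed.
End SquareZero.

Ltac lmod_ring := apply: sqz_vec_inj;
  rewrite ?(sqz_vecD, sqz_vecN, sqz_vecZ, sqz_vec0, sqz_scD, sqz_scN, sqz_scM, sqz_sc1, sqz_sc0); ring.

Section LinearProp.
Context (K : pzRingType) (U V : lmodType K) (h : U -> V).
Context (hl : linear h).
Lemma linD : {morph h : x y / x + y}.
Proof. by move=> x y; have := hl 1 x y; rewrite !scale1r. Qed.
Lemma lin0 : h 0 = 0.
Proof. by apply: (addIr (h 0)); rewrite -linD !add0r. Qed.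
Lemma linZ k x : h (k *: x) = k *: h x.
Proof. by have := hl k x 0; rewrite lin0 !addr0. Qed.
Lemma linB : {morph h : x y / x - y}.
Proof. exact: morphD_zmod linD. Qed.
Lemma linN x : h (- x) = - h x.
Proof. by rewrite -(sub0r x) linB lin0 sub0r. Qed.
End LinearProp.

Lemma lin_intro (K : pzRingType) (U V : lmodType K) (h : U -> V) :
  {morph h : x y / x + y} -> (forall k x, h (k *: x) = k *: h x) -> linear h.
Proof. by move=> hD hZ k x y; rewrite hD hZ. Qed.

Definition bilinear_map (K : pzRingType) (U V W : lmodType K) (b : U -> V -> W) :=
  (forall v, linear (b^~ v)) /\ (forall u, linear (b u)).

Section Derivations.
Context (R A : comPzRingType) (eta : {rmorphism R -> A}).

Definition is_derivation (D : A -> A) :=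
  [/\ forall f g, D (f + g) = D f + D g,
      forall r f, D (eta r * f) = eta r * D f &
      forall f g, D (f * g) = D f * g + f * D g].

Record der := Der { der_fun :> A -> A; der_prop : is_derivation der_fun }.

Lemma der_eq (D E : der) : (forall f, D f = E f) -> D = E.
Proof.
case: D E => [D hD] [E hE] /= e.
have {}e : D = E by exact: functional_extensionality_dep.
by rewrite e in hD *; congr Der; exact: Prop_irrelevance.
Qed.

HB.instance Definition _ := gen_eqMixin der.
HB.instance Definition _ := gen_choiceMixin der.

Lemma derD (D : der) f g : D (f + g) = D f + D g. Proof. by case: D => D []. Qed.
Lemma derR (D : der) r f : D (eta r * f) = eta r * D f.
Proof. by case: D => D []. Qed.
Lemma derM (D : der) f g : D (f * g) = D f * g + f * D g.
Proof. by case: D => D []. Qed.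
Lemma der0 (D : der) : D 0 = 0.
Proof. by apply: (addIr (D 0)); rewrite -derD !add0r. Qed.
Lemma derB (D : der) f g : D (f - g) = D f - D g.
Proof. by apply: (addIr (D g)); rewrite -derD !subrK. Qed.
Lemma der1 (D : der) : D 1 = 0.
Proof. by apply: (addIr (D 1)); have := derM D 1 1; rewrite !mulr1 mul1r add0r. Qed.
Lemma der_eta (D : der) r : D (eta r) = 0.
Proof. by rewrite -(mulr1 (eta r)) derR der1 mulr0. Qed.

Definition der_zero : der.
Proof. by exists (fun=> 0); split=> *; rewrite ?mulr0 ?mul0r ?addr0. Defined.
Definition der_add (D E : der) : der.
Proof.
exists (fun f => D f + E f); split=> [f g|r f|f g].
- by rewrite !derD addrACA.
- by rewrite !derR mulrDr.
- by rewrite !derM mulrDl mulrDr addrACA.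
Defined.
Definition der_opp (D : der) : der.
Proof.
exists (fun f => - D f); split=> [f g|r f|f g].
- by rewrite derD opprD.
- by rewrite derR mulrN.
- by rewrite derM opprD mulNr mulrN.
Defined.
Definition der_scale (a : A) (D : der) : der.
Proof.
exists (fun f => a * D f); split=> [f g|r f|f g].
- by rewrite derD mulrDr.
- by rewrite derR mulrCA.
- by rewrite derM mulrDr mulrA [in X in _ + X]mulrCA.
Defined.
Definition der_bracket (D E : der) : der.
Proof.
exists (fun f => D (E f) - E (D f)); split=> [f g|r f|f g].
- by rewrite !derD opprD addrACA.
- by rewrite !derR mulrBr.
- rewrite !derM !derD !derM; ring.
Defined.

Fact der_addA : associative der_add.
Proof. by move=> x y z; apply: der_eq => k /=; rewrite addrA. Qed.
Fact der_addC : commutative der_add.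
Proof. by move=> x y; apply: der_eq => k /=; rewrite addrC. Qed.
Fact der_add0 : left_id der_zero der_add.
Proof. by move=> x; apply: der_eq => k /=; rewrite add0r. Qed.
Fact der_addN : left_inverse der_zero der_opp der_add.
Proof. by move=> x; apply: der_eq => k /=; rewrite addNr. Qed.
HB.instance Definition _ := GRing.isZmodule.Build der
  der_addA der_addC der_add0 der_addN.
Fact der_scaleA a b v : der_scale a (der_scale b v) = der_scale (a * b) v.
Proof. by apply: der_eq => k /=; rewrite mulrA. Qed.
Fact der_scale1 : left_id 1 der_scale.
Proof. by move=> x; apply: der_eq => k /=; rewrite mul1r. Qed.
Fact der_scaleDr : right_distributive der_scale +%R.
Proof. by move=> a x y; apply: der_eq => k /=; rewrite mulrDr. Qed.
Fact der_scaleDl v : {morph der_scale^~ v : a b / a + b}.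
Proof. by move=> a b; apply: der_eq => k /=; rewrite mulrDl. Qed.
HB.instance Definition _ := GRing.Zmodule_isLmodule.Build A der
  der_scaleA der_scale1 der_scaleDr der_scaleDl.

Lemma der_addE (D E : der) f : (D + E) f = D f + E f. Proof. by []. Qed.
Lemma der_oppE (D : der) f : (- D) f = - D f. Proof. by []. Qed.
Lemma der_scaleE a (D : der) f : (a *: D) f = a * D f. Proof. by []. Qed.
End Derivations.

Definition is_leibniz_bracket (K : comPzRingType) (V : lmodType K)
  (br : V -> V -> V) : Prop :=
  bilinear_map br /\
  forall x y z, br x (br y z) = br (br x y) z + br y (br x z).

(* [ml x] and [mr ^~ x] are the operators $\mu^\ell(x)$ and $\mu^r(x)$. *)
Definition is_leibniz_module (K : comPzRingType) (V W : lmodType K)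
  (br : V -> V -> V) (ml : V -> W -> W) (mr : W -> V -> W) : Prop :=
  [/\ bilinear_map ml, bilinear_map mr,
      forall x y w, mr w (br x y) = mr (mr w x) y + ml x (mr w y),
      forall x y w, mr w (br x y) = ml x (mr w y) - mr (ml x w) y &
      forall x y w, ml (br x y) w = ml x (ml y w) - ml y (ml x w)].

Section Structures.
Context (R A : comPzRingType) (eta : {rmorphism R -> A}).

Record anchored := Anchored {
  anch_mod :> lmodType A;
  anchor : {linear anch_mod -> der eta} }.

Record anchored_hom (M N : anchored) := AnchoredHom {
  ah_fun :> {linear M -> N};
  ah_anchor : forall m, anchor N (ah_fun m) = anchor M m }.

Record leibniz_pseudo := LeibnizPseudo {
  lp_anch :> anchored;
  lbr : lp_anch -> lp_anch -> lp_anch;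
  lbr_leibniz : is_leibniz_bracket (V := restr eta lp_anch) lbr;
  lbrZr : forall f X Y, lbr X (f *: Y) = f *: lbr X Y + anchor lp_anch X f *: Y;
  anchor_lbr : forall X Y,
    anchor lp_anch (lbr X Y) = der_bracket (anchor lp_anch X) (anchor lp_anch Y) }.

Definition sbr (E : leibniz_pseudo) (X Y : E) : E := lbr X Y + lbr Y X.

Definition is_symmetric (E : leibniz_pseudo) : Prop :=
  (forall f (X Y : E), sbr X (f *: Y) - sbr (f *: X) Y = 0) /\
  (forall f (X Y Z : E),
     lbr (f *: X) (sbr Y Z) - sbr (lbr X Y) (f *: Z) - sbr (f *: Y) (lbr X Z) = 0).

Record sym_leibniz_pseudo := SymLeibnizPseudo {
  slp_lp :> leibniz_pseudo;
  slp_sym : is_symmetric slp_lp }.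

Record lp_hom (E F : leibniz_pseudo) := LpHom {
  lh_ah :> anchored_hom E F;
  lh_br : forall X Y, lh_ah (lbr X Y) = lbr (lh_ah X) (lh_ah Y) }.

Record lp_module (E : leibniz_pseudo) := LpModule {
  lpm_mod :> lmodType A;
  actl : E -> lpm_mod -> lpm_mod;
  actr : lpm_mod -> E -> lpm_mod;
  act_leibniz : is_leibniz_module (V := restr eta E) (W := restr eta lpm_mod)
    (@lbr E) actl actr;
  actlZr : forall f X w, actl X (f *: w) = f *: actl X w + anchor E X f *: w }.

Record lp_module_hom (E E' : leibniz_pseudo) (W : lp_module E)
    (W' : lp_module E') := LpModuleHom {
  mh1 : lp_hom E E';
  mh2 : {linear W -> W'};
  mh_actl : forall X w, actl (mh1 X) (mh2 w) = mh2 (actl X w);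
  mh_actr : forall w X, actr (mh2 w) (mh1 X) = mh2 (actr w X) }.

Record pre_courant := PreCourant {
  pc_E1 : leibniz_pseudo;
  pc_E2 : lp_module pc_E1;
  pairing : pc_E1 -> pc_E1 -> pc_E2;
  pairing_bilin : bilinear_map pairing;
  pairing_sym : forall X Y, pairing X Y = pairing Y X;
  pairing_actl : forall X Y Z,
    actl X (pairing Y Z) = pairing (lbr X Y) Z + pairing Y (lbr X Z);
  pairing_actr : forall X Y Z,
    - actr (pairing Y Z) X = pairing (lbr Y Z + lbr Z Y) X;
  pairing_inv : forall X Y Z,
    pairing (lbr X Y) Z + pairing Y (lbr X Z) = pairing (lbr Y Z + lbr Z Y) X }.

Record courant := Courant {
  gc_pre :> pre_courant;
  gc_sym : is_symmetric (pc_E1 gc_pre) }.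

Record courant_hom (C C' : pre_courant) := CourantHom {
  ch_mh :> lp_module_hom (pc_E2 C) (pc_E2 C');
  ch_pairing : forall X Y,
    pairing (mh1 ch_mh X) (mh1 ch_mh Y) = mh2 ch_mh (pairing X Y) }.
End Structures.

Section Free.
Context (R A : comPzRingType) (eta : {rmorphism R -> A}) (M : anchored eta).
Local Notation rM := (restr eta M : lmodType R).

(* [tpow k] is the tensor power of [M] over [R] with [k.+1] factors. *)
Fixpoint tpow (k : nat) : lmodType R :=
  if k is k'.+1 then (tensor rM (tpow k') : lmodType R) else rM.

Local Notation F := (dsum tpow).

Definition tincl (m : M) : F := @dsum_in R tpow 0 m.

Definition tcons (m : M) : F -> F :=
  dsum_lift (fun k (t : tpow k) => @dsum_in R tpow k.+1 (tens (m : rM) t)).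

Lemma tincl_lin : linear (tincl : rM -> F).
Proof. exact: (@dsum_in_linear R tpow 0). Qed.

Let tcons_k m k (t : tpow k) : F := @dsum_in R tpow k.+1 (tens (m : rM) t).
Let tcons_kD m k : {morph @tcons_k m k : x y / x + y}.
Proof. by move=> x y; rewrite /tcons_k tensDr raddfD. Qed.
Let tcons_kB m k : zmod_morphism (@tcons_k m k).
Proof. exact/morphD_zmod/tcons_kD. Qed.

Lemma tcons_in m k (t : tpow k) :
  tcons m (dsum_in t) = @dsum_in R tpow k.+1 (tens (m : rM) t).
Proof. exact: (dsum_lift_in t (tcons_kB m)). Qed.

Let tconsD m : {morph tcons m : x y / x + y}.
Proof. exact/zmod_morphD/dsum_lift_additive/tcons_kB. Qed.
Let tcons0 m : tcons m 0 = 0.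
Proof. by apply: (addIr (tcons m 0)); rewrite -tconsD !add0r. Qed.

Lemma tcons_bilin : bilinear_map (tcons : rM -> F -> F).
Proof.
split=> [x|m].
  elim/dsum_ind: x => [|x y hx hy|n v] a m m'.
  - by rewrite !tcons0 scaler0 addr0.
  - by rewrite !tconsD hx hy scalerDr addrACA.
  by rewrite !tcons_in (tensDl (a *: m : rM)) tensZl linearP.
apply: lin_intro => [|a x]; first exact: tconsD.
elim/dsum_ind: x => [|x y hx hy|n v]; first by rewrite scaler0 tcons0 scaler0.
  by rewrite scalerDr !tconsD hx hy scalerDr.
by rewrite -linearZ_LR !tcons_in tensZr linearZ_LR.
Qed.

Lemma tfree_ind (P : F -> Prop) :
  (forall x y, P x -> P y -> P (x + y)) -> (forall m, P (tincl m)) ->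
  (forall m x, P x -> P (tcons m x)) -> forall x, P x.
Proof.
move=> PD Pi Pc; have P0 : P 0 by rewrite -(lin0 tincl_lin); exact: Pi.
apply: dsum_ind => //; elim=> [|n ih] v; first exact: Pi.
elim/tens_ind: v => [|x y hx hy|m t]; first by rewrite raddf0.
  by rewrite raddfD; exact: PD.
by rewrite -tcons_in; exact/Pc/ih.
Qed.

Section Rec.
Context (Z : lmodType R) (h0 : M -> Z) (op : M -> Z -> Z).

Fixpoint trec_k (k : nat) : tpow k -> Z :=
  if k is k'.+1 return tpow k -> Z
  then tens_lift (fun (m : rM) (t : tpow k') => op m (trec_k t))
  else h0.

(* The map sending [m] to [h0 m] and $m\otimes t$ to [op m] of the image of
   [t]; [op] need only be bilinear on a submodule [Q], see [trec_spec]. *)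
Definition trec : F -> Z := dsum_lift trec_k.

Record trec_ok (Q : Z -> Prop) : Prop := TrecOk {
  tok0 : Q 0;
  tokD : forall x y, Q x -> Q y -> Q (x + y);
  tok_h0 : forall m, Q (h0 m);
  tok_op : forall m z, Q z -> Q (op m z);
  tok_h0l : linear (h0 : rM -> Z);
  tok_opr : forall m a x y, Q x -> Q y -> op m (a *: x + y) = a *: op m x + op m y;
  tok_opl : forall z, Q z -> linear (op^~ z : rM -> Z) }.

Context (Q : Z -> Prop) (ok : trec_ok Q).

Let op0 m : op m 0 = 0.
Proof.
have := tok_opr ok m 1 (tok0 ok) (tok0 ok); rewrite !scale1r addr0.
by move=> e; apply: (addIr (op m 0)); rewrite -e add0r.
Qed.

Let trec_bal k : linear (@trec_k k) -> (forall t, Q (@trec_k k t)) ->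
  balanced (fun (m : rM) (t : tpow k) => op m (trec_k t)).
Proof.
move=> lk Qk; split=> [m m' t|m t t'|a m t].
- exact: (linD (tok_opl ok (Qk t))).
- by rewrite (linD lk) -[trec_k t]scale1r (tok_opr ok) // !scale1r.
rewrite (linZ (tok_opl ok (Qk t))) (linZ lk) -[a *: trec_k t]addr0.
by rewrite (tok_opr ok m a (Qk t) (tok0 ok)) op0 addr0.
Qed.

Lemma trec_k_spec k : linear (@trec_k k) /\ forall t, Q (@trec_k k t).
Proof.
elim: k => [|k [lk Qk]]; first by split; [exact: (tok_h0l ok)|exact: (tok_h0 ok)].
have bal := trec_bal lk Qk.
have LD : {morph @trec_k k.+1 : x y / x + y}.
  exact/zmod_morphD/tens_lift_additive.
have L0 : @trec_k k.+1 0 = 0.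
  by apply: (addIr (@trec_k k.+1 0)); rewrite -LD !add0r.
have LE m t : @trec_k k.+1 (tens (m : rM) t) = op m (trec_k t).
  exact: tens_liftE.
split; last first.
  elim/tens_ind => [|x y hx hy|m t]; first by rewrite L0; exact: (tok0 ok).
    by rewrite LD; exact: (tokD ok).
  by rewrite LE; apply: (tok_op ok); exact: Qk.
apply: lin_intro => // a; elim/tens_ind => [|x y hx hy|m t].
- by rewrite scaler0 L0 scaler0.
- by rewrite scalerDr !LD scalerDr hx hy.
by rewrite -tensZl !LE (linZ (tok_opl ok (Qk t))).
Qed.

Let trec_kB k : zmod_morphism (@trec_k k).
Proof. by case: (trec_k_spec k) => l _; exact: linB. Qed.

Lemma trec_lin : linear trec.
Proof.
have LD : {morph trec : x y / x + y}.
  exact/zmod_morphD/dsum_lift_additive/trec_kB.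
have L0 : trec 0 = 0 by apply: (addIr (trec 0)); rewrite -LD !add0r.
apply: lin_intro => // a; elim/dsum_ind => [|x y hx hy|n v].
- by rewrite scaler0 L0 scaler0.
- by rewrite scalerDr !LD scalerDr hx hy.
rewrite -linearZ_LR /trec !dsum_lift_in //.
by case: (trec_k_spec n) => l _; exact: linZ.
Qed.

Lemma trec_incl m : trec (tincl m) = h0 m.
Proof. exact: (@dsum_lift_in R tpow Z trec_k 0 m trec_kB). Qed.

Lemma trec_cons m x : trec (tcons m x) = op m (trec x).
Proof.
have LD := linD trec_lin; have L0 := lin0 trec_lin.
have trecQ y : Q (trec y).
  elim/dsum_ind: y => [|x1 y hx hy|n v]; first by rewrite L0; exact: (tok0 ok).
    by rewrite LD; exact: (tokD ok).
  by rewrite /trec dsum_lift_in //; case: (trec_k_spec n).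
elim/dsum_ind: x => [|x y hx hy|n v].
- by rewrite (lin0 (tcons_bilin.2 m)) L0 op0.
- rewrite (linD (tcons_bilin.2 m)) !LD hx hy.
  by rewrite -[in RHS](scale1r (trec x)) (tok_opr ok) // scale1r.
rewrite tcons_in /trec !dsum_lift_in //=; apply: tens_liftE.
by case: (trec_k_spec n); exact: trec_bal.
Qed.
End Rec.

Local Notation rA := (restr eta (A^o : lmodType A)).

(* $f(m\otimes t)=m\otimes ft-a(m)(f)\,t$, as a recursion on functions of [f]. *)
Let tact_op (m : M) (g : A -> F) (f : A) : F := tcons m (g f) - g (anchor M m f).
Definition tact_rec : F -> A -> F :=
  trec (Z := A -> F) (fun m f => tincl (f *: m)) tact_op.

Lemma tact_ok : trec_ok (Z := A -> F) (fun m f => tincl (f *: m)) tact_op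
  (fun g => linear (g : rA -> F)).
Proof.
have D := linD (tcons_bilin.2 _); have Z := linZ (tcons_bilin.2 _).
split.
- by move=> a f g; rewrite scaler0 addr0.
- by move=> g h hg hh a f f'; rewrite /= [LHS]/(_ + _) hg hh scalerDr addrACA.
- move=> m a f f'; rewrite -tincl_lin; congr tincl.
  change ((eta a * f + f') *: m = eta a *: (f *: m) + f' *: m).
  by rewrite scalerDl scalerA.
- move=> m g hg; apply: lin_intro => [f f'|a f]; rewrite /tact_op.
    by rewrite derD !(linD hg) D opprD addrACA.
  have -> : anchor M m (a *: (f : rA)) = a *: (anchor M m f : rA) by exact: derR.
  by rewrite !(linZ hg) Z scalerBr.
- move=> a m m'; apply: funext => f; rewrite -[RHS]tincl_lin; congr tincl.
  change (f *: (eta a *: m + m') = eta a *: (f *: m) + f *: m').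
  by rewrite scalerDr !scalerA mulrC.
- move=> m a g h hg hh; apply: funext => f; rewrite /tact_op.
  change (tcons m (a *: g f + h f) - (a *: g (anchor M m f) + h (anchor M m f)) =
          a *: (tcons m (g f) - g (anchor M m f)) + (tcons m (h f) - h (anchor M m f))).
  by rewrite D Z; lmod_ring.
move=> g hg a m m'; apply: funext => f; rewrite /tact_op.
change (tcons (a *: (m : rM) + m') (g f) - g (anchor M (eta a *: m + m') f) =
  a *: (tcons m (g f) - g (anchor M m f)) + (tcons m' (g f) - g (anchor M m' f))).
rewrite (tcons_bilin.1 (g f)) linearP.
have -> : (eta a *: anchor M m + anchor M m') f = a *: (anchor M m f : rA) + anchor M m' f by [].
by rewrite hg; lmod_ring.
Qed.

Definition tact (f : A) (x : F) : F := tact_rec x f.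

Lemma tact_incl f m : tact f (tincl m) = tincl (f *: m).
Proof. by rewrite /tact /tact_rec (trec_incl tact_ok). Qed.
Lemma tact_cons f m x : tact f (tcons m x) = tcons m (tact f x) - tact (anchor M m f) x.
Proof. by rewrite /tact /tact_rec (trec_cons tact_ok). Qed.
Lemma tactDr f : {morph tact f : x y / x + y}.
Proof. by move=> x y; rewrite /tact /tact_rec (linD (trec_lin tact_ok)). Qed.
Lemma tactDl x : {morph tact^~ x : f g / f + g}.
Proof.
elim/tfree_ind: x => [x y hx hy|m|m x hx] f g.
- by rewrite !tactDr hx hy addrACA.
- by rewrite !tact_incl scalerDl (linD tincl_lin).
by rewrite !tact_cons derD !hx (linD (tcons_bilin.2 m)) opprD addrACA.
Qed.
Lemma tactBr f : {morph tact f : x y / x - y}.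
Proof. exact: morphD_zmod (tactDr f). Qed.
Lemma tact1 x : tact 1 x = x.
Proof.
have t0 y : tact 0 y = 0 by apply: (addIr (tact 0 y)); rewrite -tactDl !add0r.
elim/tfree_ind: x => [x y hx hy|m|m x hx].
- by rewrite tactDr hx hy.
- by rewrite tact_incl scale1r.
by rewrite tact_cons hx der1 t0 subr0.
Qed.
Lemma tactA f g x : tact f (tact g x) = tact (f * g) x.
Proof.
elim/tfree_ind: x f g => [x y hx hy|m|m x hx] f g.
- by rewrite !tactDr hx hy.
- by rewrite !tact_incl scalerA.
rewrite !tact_cons tactBr tact_cons !hx derM tactDl [anchor M m f * g]mulrC.
by rewrite [g * _]mulrC opprD addrA addrAC.
Qed.
Lemma tact_eta r x : tact (eta r) x = r *: x.
Proof.
have t0 y : tact 0 y = 0 by apply: (addIr (tact 0 y)); rewrite -tactDl !add0r.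
elim/tfree_ind: x => [x y hx hy|m|m x hx].
- by rewrite tactDr hx hy scalerDr.
- by rewrite tact_incl -(linZ tincl_lin).
by rewrite tact_cons hx der_eta t0 subr0 (linZ (tcons_bilin.2 m)).
Qed.

(* The Leibniz identity forces $[m\otimes x,y]=[[m,x],y]=m\otimes[x,y]-[x,m\otimes y]$
   once $[m,x]=m\otimes x$. *)
Let tbr_op (m : M) (g : F -> F) (y : F) : F := tcons m (g y) - g (tcons m y).
Definition tbr : F -> F -> F := trec (Z := F -> F) tcons tbr_op.

Lemma tbr_ok : trec_ok (Z := F -> F) tcons tbr_op (fun g => linear g).
Proof.
split.
- by move=> a f g; rewrite scaler0 addr0.
- by move=> g h hg hh a f f'; rewrite /= [LHS]/(_ + _) hg hh scalerDr addrACA.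
- by move=> m; exact: tcons_bilin.2.
- move=> m g hg a x y; rewrite /tbr_op hg !(tcons_bilin.2 m) hg; lmod_ring.
- by move=> a m m'; apply: funext => y; exact: tcons_bilin.1.
- move=> m a g h hg hh; apply: funext => y; rewrite /tbr_op.
  change (tcons m (a *: g y + h y) - (a *: g (tcons m y) + h (tcons m y)) =
          a *: (tcons m (g y) - g (tcons m y)) + (tcons m (h y) - h (tcons m y))).
  by rewrite (tcons_bilin.2 m); lmod_ring.
move=> g hg a m m'; apply: funext => y; rewrite /tbr_op.
change (tcons (a *: (m : rM) + m') (g y) - g (tcons (a *: (m : rM) + m') y) =
  a *: (tcons m (g y) - g (tcons m y)) + (tcons m' (g y) - g (tcons m' y))).
by rewrite !(tcons_bilin.1 _) hg; lmod_ring.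
Qed.

Lemma tbr_incl m y : tbr (tincl m) y = tcons m y.
Proof. by rewrite /tbr (trec_incl tbr_ok). Qed.
Lemma tbr_cons m x y : tbr (tcons m x) y = tcons m (tbr x y) - tbr x (tcons m y).
Proof. by rewrite /tbr (trec_cons tbr_ok). Qed.
Lemma tbr_linl y : linear (tbr^~ y).
Proof. by move=> a x x'; rewrite /tbr (trec_lin tbr_ok). Qed.
Lemma tbr_linr x : linear (tbr x).
Proof.
elim/tfree_ind: x => [x y hx hy|m|m x hx] a z z'.
- by rewrite !(linD (tbr_linl _)) hx hy scalerDr addrACA.
- by rewrite !tbr_incl (tcons_bilin.2 m).
by rewrite !tbr_cons hx !(tcons_bilin.2 m) hx; lmod_ring.
Qed.

Lemma tbr_leibniz x y z : tbr x (tbr y z) = tbr (tbr x y) z + tbr y (tbr x z).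
Proof.
elim/tfree_ind: x y z => [x x' hx hx'|m|m x hx] y z.
- rewrite !(linD (tbr_linl _)) hx hx' (linD (tbr_linr _)); lmod_ring.
- by rewrite !tbr_incl tbr_cons subrK.
have C u v : tcons m (tbr u v) = tbr (tcons m u) v + tbr u (tcons m v).
  by rewrite tbr_cons subrK.
rewrite !(tbr_cons m x) hx (linD (tcons_bilin.2 m)) (C (tbr x y)) (C y).
rewrite (C y z) (linD (tbr_linr x)) !hx (linB (tbr_linr _)) (linB (tbr_linl _)).
lmod_ring.
Qed.

Local Notation rD := (restr eta (der eta : lmodType A)).
(* $\mathrm{F}a(m\otimes x)=[a(m),\mathrm{F}a(x)]$ *)
Definition tanch : F -> der eta :=
  trec (Z := rD) (anchor M) (fun m D => der_bracket (anchor M m) D).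

Lemma tanch_ok : trec_ok (Z := rD) (anchor M)
  (fun m D => der_bracket (anchor M m) D) (fun _ => True).
Proof.
split=> //.
- by move=> a m m'; exact: (linearP (anchor M)).
- move=> m a D E _ _; apply: der_eq => f /=.
  change (anchor M m (eta a * D f + E f) -
    (eta a * D (anchor M m f) + E (anchor M m f)) =
    eta a * (anchor M m (D f) - D (anchor M m f)) +
    (anchor M m (E f) - E (anchor M m f))).
  by rewrite derD derR; ring.
- move=> D _ a m m'; apply: der_eq => f /=.
  change (anchor M (eta a *: m + m') (D f) - D (anchor M (eta a *: m + m') f) =
    eta a * (anchor M m (D f) - D (anchor M m f)) +
    (anchor M m' (D f) - D (anchor M m' f))).
  rewrite linearP.
  have L g : (eta a *: anchor M m + anchor M m' : der eta) g =
    eta a * anchor M m g + anchor M m' g by [].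
  rewrite !L.
  by rewrite derD derR; ring.
Qed.

Lemma tanch_incl m : tanch (tincl m) = anchor M m.
Proof. by rewrite /tanch (trec_incl tanch_ok). Qed.
Lemma tanch_cons m x : tanch (tcons m x) = der_bracket (anchor M m) (tanch x).
Proof. by rewrite /tanch (trec_cons tanch_ok). Qed.
Lemma tanchD : {morph tanch : x y / x + y}.
Proof. exact: linD (trec_lin tanch_ok). Qed.
Lemma tanchB : {morph tanch : x y / x - y}.
Proof. exact: linB (trec_lin tanch_ok). Qed.

Lemma tbr_act f x y : tbr x (tact f y) = tact f (tbr x y) + tact (tanch x f) y.
Proof.
elim/tfree_ind: x f y => [x x' hx hx'|m|m x hx] f y.
- by rewrite !(linD (tbr_linl _)) hx hx' tanchD tactDl tactDr addrACA.
- by rewrite !tbr_incl tanch_incl tact_cons subrK.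
have C g u : tcons m (tact g u) = tact g (tcons m u) + tact (anchor M m g) u.
  by rewrite tact_cons subrK.
have E : tact (tanch (tcons m x) f) y =
    tact (anchor M m (tanch x f)) y - tact (tanch x (anchor M m f)) y.
  by apply: (addIr (tact (tanch x (anchor M m f)) y)); rewrite -tactDl tanch_cons !subrK.
rewrite !tbr_cons hx (linD (tcons_bilin.2 m)) !C (linD (tbr_linr x)) !hx E tactBr.
lmod_ring.
Qed.

Lemma tanch_act f x : tanch (tact f x) = f *: tanch x.
Proof.
elim/tfree_ind: x f => [x x' hx hx'|m|m x hx] f.
- by rewrite tactDr !tanchD hx hx' scalerDr.
- by rewrite tact_incl !tanch_incl linearZ.
rewrite tact_cons tanchB !tanch_cons !hx; apply: der_eq => g.
change (anchor M m (f * tanch x g) - f * tanch x (anchor M m g) -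
        anchor M m f * tanch x g =
        f * (anchor M m (tanch x g) - tanch x (anchor M m g))).
by rewrite derM; ring.
Qed.

Lemma tanch_br x y : tanch (tbr x y) = der_bracket (tanch x) (tanch y).
Proof.
elim/tfree_ind: x y => [x x' hx hx'|m|m x hx] y.
- rewrite (linD (tbr_linl _)) !tanchD hx hx'; apply: der_eq => g /=.
  change (tanch x (tanch y g) - tanch y (tanch x g) +
         (tanch x' (tanch y g) - tanch y (tanch x' g)) =
         tanch x (tanch y g) + tanch x' (tanch y g) - tanch y (tanch x g + tanch x' g)).
  by rewrite derD; ring.
- by rewrite tbr_incl tanch_incl tanch_cons.
rewrite tbr_cons tanchB !tanch_cons !hx !tanch_cons; apply: der_eq => g.
change (anchor M m (tanch x (tanch y g) - tanch y (tanch x g)) -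
  (tanch x (tanch y (anchor M m g)) - tanch y (tanch x (anchor M m g))) -
  (tanch x (anchor M m (tanch y g) - tanch y (anchor M m g)) -
   (anchor M m (tanch y (tanch x g)) - tanch y (anchor M m (tanch x g)))) =
  anchor M m (tanch x (tanch y g)) - tanch x (anchor M m (tanch y g)) -
  tanch y (anchor M m (tanch x g) - tanch x (anchor M m g))).
by rewrite !derB; ring.
Qed.

(* A copy of $\bigoplus_{k\ge 1}M^{\otimes_R k}$ carrying the [A]-module
   structure; its restriction along [eta] is the original [R]-module structure
   by [tact_eta]. *)
Definition free_car : Type := F.
HB.instance Definition _ := GRing.Zmodule.on free_car.
Fact free_scaleDr : right_distributive (tact : A -> free_car -> free_car) +%R.
Proof. exact: tactDr. Qed.
HB.instance Definition _ := GRing.Zmodule_isLmodule.Build A free_car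
  tactA tact1 free_scaleDr tactDl.

Definition free_anchor : free_car -> der eta := tanch.
Fact free_anchor_linear : linear free_anchor.
Proof. by move=> f x y; rewrite -tanch_act -tanchD. Qed.
HB.instance Definition _ :=
  GRing.isLinear.Build A free_car (der eta) *:%R free_anchor free_anchor_linear.

Definition free_anchored : anchored eta :=
  @Anchored R A eta (free_car : lmodType A) free_anchor.

Fact free_leibniz :
  @is_leibniz_bracket R (restr eta free_anchored : lmodType R) tbr.
Proof.
have rE r (x : F) : tact (eta r) x = r *: x := tact_eta r x.
split; last exact: tbr_leibniz.
split=> [y|x] a u v.
  by change (tbr (tact (eta a) u + v) y = tact (eta a) (tbr u y) + tbr v y);
     rewrite !rE; exact: tbr_linl.
by change (tbr x (tact (eta a) u + v) = tact (eta a) (tbr x u) + tbr x v);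
   rewrite !rE; exact: tbr_linr.
Qed.

(* $\mathrm{F}\mathcal{M}$ *)
Definition free_lp : leibniz_pseudo eta :=
  @LeibnizPseudo R A eta free_anchored tbr free_leibniz tbr_act tanch_br.

Definition free_incl_fun : M -> free_lp := tincl.
Fact free_incl_linear : linear free_incl_fun.
Proof. by move=> f m m'; rewrite /free_incl_fun (linD tincl_lin) -tact_incl. Qed.
HB.instance Definition _ :=
  GRing.isLinear.Build A M free_lp *:%R free_incl_fun free_incl_linear.

Definition free_incl : anchored_hom M free_lp :=
  @AnchoredHom R A eta M free_lp free_incl_fun tanch_incl.
End Free.

Section LbrTheory.
Context (R A : comPzRingType) (eta : {rmorphism R -> A}) (E : leibniz_pseudo eta).
Implicit Types X Y Z : E.
Lemma lbrDl X X' Y : lbr (X + X') Y = lbr X Y + lbr X' Y.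
Proof. exact: (linD ((lbr_leibniz E).1.1 Y)). Qed.
Lemma lbrDr X Y Y' : lbr X (Y + Y') = lbr X Y + lbr X Y'.
Proof. exact: (linD ((lbr_leibniz E).1.2 X)). Qed.
Lemma lbrRl r X Y : lbr (eta r *: X) Y = eta r *: lbr X Y.
Proof. exact: (linZ ((lbr_leibniz E).1.1 Y)). Qed.
Lemma lbrRr r X Y : lbr X (eta r *: Y) = eta r *: lbr X Y.
Proof. exact: (linZ ((lbr_leibniz E).1.2 X)). Qed.
Lemma lbrBl X X' Y : lbr (X - X') Y = lbr X Y - lbr X' Y.
Proof. exact: (linB ((lbr_leibniz E).1.1 Y)). Qed.
Lemma lbrBr X Y Y' : lbr X (Y - Y') = lbr X Y - lbr X Y'.
Proof. exact: (linB ((lbr_leibniz E).1.2 X)). Qed.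
Lemma lbr0l Y : lbr (0 : E) Y = 0.
Proof. exact: (lin0 ((lbr_leibniz E).1.1 Y)). Qed.
Lemma lbr0r X : lbr X (0 : E) = 0.
Proof. exact: (lin0 ((lbr_leibniz E).1.2 X)). Qed.
Lemma lbrA X Y Z : lbr X (lbr Y Z) = lbr (lbr X Y) Z + lbr Y (lbr X Z).
Proof. exact: (lbr_leibniz E).2. Qed.
Lemma sbrC X Y : sbr X Y = sbr Y X. Proof. exact: addrC. Qed.
Lemma lbr_sbr0 X Y Z : lbr (sbr X Y) Z = 0.
Proof.
apply: (addIr (lbr Y (lbr X Z) + lbr X (lbr Y Z))).
by rewrite add0r lbrDl addrACA -!lbrA addrC.
Qed.
Lemma lbr_sbr X Y Z : lbr X (sbr Y Z) = sbr (lbr X Y) Z + sbr Y (lbr X Z).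
Proof. by rewrite lbrDr (lbrA X Y) (lbrA X Z) /sbr; lmod_ring. Qed.
Lemma sbrDr X Y Z : sbr X (Y + Z) = sbr X Y + sbr X Z.
Proof. by rewrite /sbr lbrDl lbrDr addrACA. Qed.
Lemma sbrDl X Y Z : sbr (X + Y) Z = sbr X Z + sbr Y Z.
Proof. by rewrite sbrC sbrDr !(sbrC Z). Qed.
Lemma sbrBr X Y Z : sbr X (Y - Z) = sbr X Y - sbr X Z.
Proof. by apply: (addIr (sbr X Z)); rewrite -sbrDr !subrK. Qed.
Lemma sbrBl X Y Z : sbr (X - Y) Z = sbr X Z - sbr Y Z.
Proof. by rewrite sbrC sbrBr !(sbrC Z). Qed.
Lemma sbr_sbr0 X Y Z : sbr X (sbr Y Z) = lbr X (sbr Y Z).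
Proof. by rewrite /sbr -/(sbr Y Z) lbr_sbr0 addr0. Qed.
Lemma anchor_sbr0 X Y : anchor E (sbr X Y) = 0.
Proof.
rewrite raddfD /= !anchor_lbr; apply: der_eq => f.
change (anchor E X (anchor E Y f) - anchor E Y (anchor E X f) +
  (anchor E Y (anchor E X f) - anchor E X (anchor E Y f)) = 0).
by ring.
Qed.
End LbrTheory.

Section SymQuotient.
Context (R A : comPzRingType) (eta : {rmorphism R -> A}) (E : leibniz_pseudo eta).

Inductive sym_rel : E -> Prop :=
| sym_rel1 f X Y : sym_rel (sbr X (f *: Y) - sbr (f *: X) Y)
| sym_rel2 f X Y Z : sym_rel
    (lbr (f *: X) (sbr Y Z) - sbr (lbr X Y) (f *: Z) - sbr (f *: Y) (lbr X Z)).

Local Notation N := (lspan sym_rel).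

Lemma anchor_sym_rel X : N X -> anchor E X = 0.
Proof.
elim=> [|k x y Sx _ ih]; first by rewrite raddf0.
rewrite linearP ih addr0; suff -> : anchor E x = 0 by rewrite scaler0.
case: Sx => [f u v|f u v w]; first by rewrite raddfB /= !anchor_sbr0 subr0.
rewrite !raddfB /= !anchor_sbr0 !subr0 anchor_lbr anchor_sbr0.
by apply: der_eq => g; change (anchor E (f *: u) 0 - 0 = 0); rewrite der0 subr0.
Qed.

Lemma lbr_sym_relr X n : N n -> N (lbr X n).
Proof.
elim=> [|k x y Sx _ ih]; first by rewrite lbr0r; exact: lspan0.
rewrite lbrDr; apply: lspanD => //; rewrite lbrZr; apply: lspanD; last first.
  exact/lspanZ/lspan_gen.
apply: lspanZ; case: Sx => {k x y ih} [f Y Z|f Y Z W].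
- have -> : lbr X (sbr Y (f *: Z) - sbr (f *: Y) Z) =
    (sbr (lbr X Y) (f *: Z) - sbr (f *: lbr X Y) Z) +
    (sbr Y (f *: lbr X Z) - sbr (f *: Y) (lbr X Z)) +
    (sbr Y (anchor E X f *: Z) - sbr (anchor E X f *: Y) Z).
    by rewrite lbrBr !lbr_sbr !lbrZr !sbrDr !sbrDl; lmod_ring.
  by apply: lspanD; [apply: lspanD|]; apply: lspan_gen; exact: sym_rel1.
have -> : lbr X (lbr (f *: Y) (sbr Z W) - sbr (lbr Y Z) (f *: W) - sbr (f *: Z) (lbr Y W)) =
   (lbr (f *: lbr X Y) (sbr Z W) - sbr (lbr (lbr X Y) Z) (f *: W) - sbr (f *: Z) (lbr (lbr X Y) W)) +
   (lbr (f *: Y) (sbr (lbr X Z) W) - sbr (lbr Y (lbr X Z)) (f *: W) - sbr (f *: lbr X Z) (lbr Y W)) +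
   (lbr (f *: Y) (sbr Z (lbr X W)) - sbr (lbr Y Z) (f *: lbr X W) - sbr (f *: Z) (lbr Y (lbr X W))) +
   (lbr (anchor E X f *: Y) (sbr Z W) - sbr (lbr Y Z) (anchor E X f *: W) - sbr (anchor E X f *: Z) (lbr Y W)).
  rewrite 2!lbrBr (lbrA X (f *: Y)) (lbr_sbr X Z W) (lbr_sbr X (lbr Y Z)).
  rewrite (lbr_sbr X (f *: Z)) !(lbrZr f X) (lbrA X Y Z) (lbrA X Y W).
  by rewrite !(lbrDl, lbrDr, sbrDr, sbrDl); lmod_ring.
by apply: lspanD; [apply: lspanD; [apply: lspanD|]|]; apply: lspan_gen; exact: sym_rel2.
Qed.

Lemma lbr_gen0 x X : sym_rel x -> lbr x X = 0.
Proof.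
case=> [f Y Z|f Y Z W]; first by rewrite lbrBl !lbr_sbr0 subr0.
rewrite !lbrBl !lbr_sbr0 !subr0.
have := lbrA (f *: Y) (sbr Z W) X.
by rewrite !lbr_sbr0 lbr0r addr0.
Qed.

Lemma lbr_sym_rell X n : N n -> N (lbr n X).
Proof.
elim=> [|k x y Sx _ ih]; first by rewrite lbr0l; exact: lspan0.
rewrite lbrDl; apply: lspanD => //.
have -> : lbr (k *: x) X = (lbr x (k *: X) + lbr (k *: X) x)
    - (sbr x (k *: X) - sbr (k *: x) X) - lbr X (k *: x).
  by rewrite /sbr; lmod_ring.
rewrite lbr_gen0 // add0r.
apply: lspanD; last by apply/lspanN/lbr_sym_relr/lspanZ/lspan_gen.
apply: lspanD; first exact/lbr_sym_relr/lspan_gen.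
exact/lspanN/lspan_gen/sym_rel1.
Qed.

Definition symq : lmodType A := lquot sym_rel.
Local Notation q := (@lq A E sym_rel).

Definition symq_anchor : symq -> der eta := lquot_lift (anchor E).
Lemma symq_anchorE X : symq_anchor (q X) = anchor E X.
Proof. by apply: lquot_liftE; [exact: raddfB|exact: anchor_sym_rel]. Qed.
Fact symq_anchor_linear : linear symq_anchor.
Proof.
move=> f; elim/lq_ind => X; elim/lq_ind => Y.
by rewrite -lqZ -raddfD !symq_anchorE linearP.
Qed.
HB.instance Definition _ :=
  GRing.isLinear.Build A symq (der eta) *:%R symq_anchor symq_anchor_linear.

Definition symq_br : symq -> symq -> symq :=
  lquot_lift (fun X => lquot_lift (fun Y => q (lbr X Y))).
Lemma symq_brE X Y : symq_br (q X) (q Y) = q (lbr X Y).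
Proof.
have H X' : forall Y', lquot_lift (fun Y => q (lbr X' Y)) (q Y') = q (lbr X' Y').
  apply: lquot_liftE => [u v|n Nn]; first by rewrite lbrBr raddfB.
  exact/lq_eq0/lbr_sym_relr.
rewrite /symq_br lquot_liftE; first exact: H.
- move=> u v; apply: funext; elim/lq_ind => Z.
  change (lquot_lift (fun Y => q (lbr (u - v) Y)) (q Z) =
    lquot_lift (fun Y => q (lbr u Y)) (q Z) - lquot_lift (fun Y => q (lbr v Y)) (q Z)).
  by rewrite !H lbrBl raddfB.
move=> n Nn; apply: funext; elim/lq_ind => Z; rewrite H.
exact/lq_eq0/lbr_sym_rell.
Qed.

Definition symq_anchored : anchored eta := @Anchored R A eta symq symq_anchor.

Fact symq_leibniz :
  @is_leibniz_bracket R (restr eta symq_anchored : lmodType R) symq_br.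
Proof.
split; last first.
  elim/lq_ind => X; elim/lq_ind => Y; elim/lq_ind => Z.
  by rewrite !symq_brE -raddfD /= lbrA.
split=> [|].
  elim/lq_ind => Y a; elim/lq_ind => X; elim/lq_ind => X'.
  change (symq_br (eta a *: q X + q X') (q Y) =
    eta a *: symq_br (q X) (q Y) + symq_br (q X') (q Y)).
  by rewrite -lqZ -raddfD !symq_brE -lqZ -raddfD lbrDl lbrRl.
elim/lq_ind => X a; elim/lq_ind => Y; elim/lq_ind => Y'.
change (symq_br (q X) (eta a *: q Y + q Y') =
  eta a *: symq_br (q X) (q Y) + symq_br (q X) (q Y')).
by rewrite -lqZ -raddfD !symq_brE -lqZ -raddfD lbrDr lbrRr.
Qed.
Fact symq_brZ f (X Y : symq) :
  symq_br X (f *: Y) = f *: symq_br X Y + symq_anchor X f *: Y.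
Proof.
elim/lq_ind: X => X; elim/lq_ind: Y => Y.
by rewrite -lqZ !symq_brE symq_anchorE -!lqZ -raddfD /= lbrZr.
Qed.
Fact symq_anchor_br X Y :
  symq_anchor (symq_br X Y) = der_bracket (symq_anchor X) (symq_anchor Y).
Proof.
elim/lq_ind: X => X; elim/lq_ind: Y => Y.
by rewrite symq_brE !symq_anchorE anchor_lbr.
Qed.

Definition symq_lp : leibniz_pseudo eta :=
  @LeibnizPseudo R A eta symq_anchored symq_br symq_leibniz symq_brZ symq_anchor_br.

Fact symq_sym : is_symmetric symq_lp.
Proof.
have sE X Y : sbr (q X : symq_lp) (q Y) = q (sbr X Y).
  by rewrite /sbr /= !symq_brE -raddfD.
split.
  move=> f; elim/lq_ind => X; elim/lq_ind => Y.
  change (sbr (q X : symq_lp) (f *: q Y) - sbr (f *: q X : symq_lp) (q Y) = 0).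
  rewrite -!lqZ !sE -raddfB; apply/lq_eq0/lspan_gen; exact: sym_rel1.
move=> f; elim/lq_ind => X; elim/lq_ind => Y; elim/lq_ind => Z.
change (symq_br (f *: q X) (sbr (q Y : symq_lp) (q Z)) -
  sbr (symq_br (q X) (q Y) : symq_lp) (f *: q Z) -
  sbr (f *: q Y : symq_lp) (symq_br (q X) (q Z)) = 0).
rewrite -!lqZ !symq_brE !sE !symq_brE -!raddfB; apply/lq_eq0/lspan_gen.
exact: sym_rel2.
Qed.

Definition symq_slp : sym_leibniz_pseudo eta := SymLeibnizPseudo symq_sym.
End SymQuotient.

Section SymQuotientMap.
Context (R A : comPzRingType) (eta : {rmorphism R -> A}) (E : leibniz_pseudo eta).

Definition symq_class : E -> symq_slp E := @lq A E (@sym_rel R A eta E).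
Fact symq_class_linear : linear symq_class.
Proof. by move=> f X Y; rewrite /symq_class raddfD /= lqZ. Qed.
HB.instance Definition _ :=
  GRing.isLinear.Build A E (symq_slp E) *:%R symq_class symq_class_linear.
End SymQuotientMap.

Section FreeSymmetric.
Context (R A : comPzRingType) (eta : {rmorphism R -> A}) (M : anchored eta).

(* $\mathrm{FS}\mathcal{M}$ and $\tilde\imath$ *)
Definition free_slp : sym_leibniz_pseudo eta := symq_slp (free_lp M).

Definition free_slp_incl_fun (m : M) : free_slp := symq_class (free_incl M m).
Fact free_slp_incl_linear : linear free_slp_incl_fun.
Proof. by move=> f m m'; rewrite /free_slp_incl_fun !linearP. Qed.
HB.instance Definition _ :=
  GRing.isLinear.Build A M free_slp *:%R free_slp_incl_fun free_slp_incl_linear.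
Fact free_slp_incl_anchor m : anchor free_slp (free_slp_incl_fun m) = anchor M m.
Proof. by rewrite [LHS]symq_anchorE; exact: (ah_anchor (free_incl M)). Qed.

Definition free_slp_incl : anchored_hom M free_slp :=
  @AnchoredHom R A eta M free_slp free_slp_incl_fun free_slp_incl_anchor.
End FreeSymmetric.

Section SymSquare.
Context (K : comPzRingType) (V : lmodType K).
Inductive symsq_rel : tensor V V -> Prop :=
| symsq_swap x y : symsq_rel (tens x y - tens y x).
Definition symsq : lmodType K := lquot symsq_rel.
Definition odot (x y : V) : symsq := lq symsq_rel (tens x y).
End SymSquare.

Section Associated.
Context (R A : comPzRingType) (eta : {rmorphism R -> A}) (E : sym_leibniz_pseudo eta).

Inductive inv_rel : symsq E -> Prop :=
| inv_gen X Y Z : inv_rel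
    (odot (lbr X Y) Z + odot Y (lbr X Z) - odot X (lbr Y Z + lbr Z Y)).

(* $\mathcal{R}(\mathcal{E})$ *)
Definition rel_mod : lmodType A := lquot inv_rel.
Definition rel_pair (X Y : E) : rel_mod := lq inv_rel (odot X Y).

Lemma rel_pairC X Y : rel_pair X Y = rel_pair Y X.
Proof.
congr (lq _ _); apply/lqP/lspan_gen; exact: symsq_swap.
Qed.
Lemma rel_pairDl X X' Y : rel_pair (X + X') Y = rel_pair X Y + rel_pair X' Y.
Proof. by rewrite /rel_pair /odot tensDl !raddfD. Qed.
Lemma rel_pairZl f X Y : rel_pair (f *: X) Y = f *: rel_pair X Y.
Proof. by rewrite /rel_pair /odot tensZl !lqZ. Qed.
Lemma rel_pairDr X Y Y' : rel_pair X (Y + Y') = rel_pair X Y + rel_pair X Y'.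
Proof. by rewrite rel_pairC rel_pairDl !(rel_pairC X). Qed.
Lemma rel_pairZr f X Y : rel_pair X (f *: Y) = f *: rel_pair X Y.
Proof. by rewrite rel_pairC rel_pairZl (rel_pairC X). Qed.
Lemma rel_pair_bilin : bilinear_map rel_pair.
Proof.
split=> [Y|X] f u v; first by rewrite rel_pairDl rel_pairZl.
by rewrite rel_pairDr rel_pairZr.
Qed.
Lemma rel_pair_inv X Y Z :
  rel_pair (lbr X Y) Z + rel_pair Y (lbr X Z) = rel_pair (lbr Y Z + lbr Z Y) X.
Proof.
rewrite (rel_pairC (_ + _) X) /rel_pair -raddfD; apply/lqP/lspan_gen.
exact: inv_gen.
Qed.

Lemma rel_ind (P : rel_mod -> Prop) : P 0 ->
  (forall x y, P x -> P y -> P (x + y)) -> (forall X Y, P (rel_pair X Y)) ->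
  forall x, P x.
Proof.
move=> P0 PD Pp; elim/lq_ind; elim/lq_ind; elim/tens_ind => [|x y hx hy|X Y].
- by rewrite !raddf0.
- by rewrite !raddfD; exact: PD.
exact: Pp.
Qed.

(* Additive maps out of $\mathcal{R}(\mathcal{E})$; only meaningful under the
   hypotheses of [rel_liftE]. *)
Definition rel_lift (Z : zmodType) (h : E -> E -> Z) : rel_mod -> Z :=
  lquot_lift (lquot_lift (tens_lift h)).

Record rel_ok (Z : zmodType) (h : E -> E -> Z) : Prop := RelOk {
  rok_bal : balanced h;
  rok_sym : forall X Y, h X Y = h Y X;
  rok_inv : forall f X Y W,
    h (f *: lbr X Y) W + h (f *: Y) (lbr X W) = h (f *: X) (lbr Y W + lbr W Y) }.

Section Lift.
Context (Z : zmodType) (h : E -> E -> Z) (ok : rel_ok h).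
Let bal := rok_bal ok.
Let L1 : symsq E -> Z := lquot_lift (tens_lift h).
Let tB := tens_lift_additive bal.
Let L1E x : L1 (lq _ x) = tens_lift h x.
Proof.
apply: lquot_liftE => // {}x; elim=> [|k s y [X Y] _ ih].
  exact: (zmod_morph0 tB).
rewrite (zmod_morphD tB) ih addr0 scalerBr tB -!tensZl !tens_liftE //.
by case: bal => _ _ hk; rewrite hk (rok_sym ok) subrr.
Qed.
Let L1B : zmod_morphism L1.
Proof. by elim/lq_ind => x; elim/lq_ind => y; rewrite -raddfB !L1E tB. Qed.
Let L2E x : rel_lift h (lq _ x) = L1 x.
Proof.
have L1N y : lspan inv_rel y -> L1 y = 0; last exact: (lquot_liftE L1B L1N).
elim=> [|k s {}y [X Y W] _ ih].
  exact: (zmod_morph0 L1B).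
have E1 k' u v : L1 (k' *: odot u v) = h (k' *: u) v.
  by rewrite /odot -lqZ L1E -tensZl tens_liftE.
rewrite (zmod_morphD L1B) ih addr0 scalerBr scalerDr L1B (zmod_morphD L1B) !E1.
by rewrite (rok_inv ok) subrr.
Qed.
Lemma rel_liftE X Y : rel_lift h (rel_pair X Y) = h X Y.
Proof. by rewrite L2E L1E tens_liftE. Qed.
Lemma rel_lift_additive : zmod_morphism (rel_lift h).
Proof. by elim/lq_ind => x; elim/lq_ind => y; rewrite -raddfB !L2E L1B. Qed.
End Lift.

(* $\tilde\mu^\ell$ and $\tilde\mu^r$ *)
Definition rel_actl (X : E) : rel_mod -> rel_mod :=
  rel_lift (fun Y1 Y2 => rel_pair (lbr X Y1) Y2 + rel_pair Y1 (lbr X Y2)).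
Definition rel_actr (w : rel_mod) (X : E) : rel_mod :=
  rel_lift (fun Y1 Y2 => - rel_pair (sbr Y1 Y2) X) w.

Let sbrZ f (X Y : E) : sbr X (f *: Y) = sbr (f *: X) Y.
Proof. by apply/eqP; rewrite -subr_eq0 ((slp_sym E).1 f X Y). Qed.

Fact rel_actl_ok X :
  rel_ok (fun Y1 Y2 => rel_pair (lbr X Y1) Y2 + rel_pair Y1 (lbr X Y2)).
Proof.
split.
- split=> [u u' v|u v v'|f u v].
  + by rewrite lbrDr !rel_pairDl addrACA.
  + by rewrite lbrDr !rel_pairDr addrACA.
  by rewrite !lbrZr !(rel_pairDl, rel_pairDr, rel_pairZl, rel_pairZr); lmod_ring.
- by move=> u v; rewrite addrC rel_pairC (rel_pairC _ v).
move=> f U Y W.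
have I1 := rel_pair_inv (lbr X U) Y W.
have I2 := rel_pair_inv U (lbr X Y) W.
have I3 := rel_pair_inv U Y (lbr X W).
have I4 := rel_pair_inv U Y W.
rewrite -!/(sbr _ _) in I1 I2 I3 I4 *.
rewrite !lbrZr (lbr_sbr X Y W) (lbrA X U Y) (lbrA X U W).
move: (sbr Y W) (sbr (lbr X Y) W) (sbr Y (lbr X W)) I1 I2 I3 I4.
move=> S1 S2 S3 I1 I2 I3 I4.
rewrite !(rel_pairDl, rel_pairDr, rel_pairZl, rel_pairZr).
rewrite (rel_pairC (lbr X U) S1) -I1 (rel_pairC U S1) -I4.
rewrite (rel_pairC U S2) -I2 (rel_pairC U S3) -I3.
lmod_ring.
Qed.

Fact rel_actr_ok X : rel_ok (fun Y1 Y2 => - rel_pair (sbr Y1 Y2) X).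
Proof.
split.
- split=> [u u' v|u v v'|f u v].
  + by rewrite sbrDl rel_pairDl opprD.
  + by rewrite sbrDr rel_pairDl opprD.
  by rewrite sbrZ.
- by move=> u v; rewrite sbrC.
move=> f U Y W; rewrite -opprD -rel_pairDl; congr (- rel_pair _ _).
rewrite -/(sbr Y W) sbr_sbr0 -sbrZ.
apply/esym/eqP; rewrite -subr_eq0 opprD addrA; apply/eqP.
exact: ((slp_sym E).2 f U Y W).
Qed.

Lemma rel_actlE X Y1 Y2 :
  rel_actl X (rel_pair Y1 Y2) = rel_pair (lbr X Y1) Y2 + rel_pair Y1 (lbr X Y2).
Proof. exact: (rel_liftE (rel_actl_ok X)). Qed.
Lemma rel_actrE X Y1 Y2 : rel_actr (rel_pair Y1 Y2) X = - rel_pair (sbr Y1 Y2) X.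
Proof. exact: (rel_liftE (rel_actr_ok X)). Qed.
Lemma rel_actlD X : {morph rel_actl X : x y / x + y}.
Proof. exact/zmod_morphD/rel_lift_additive/rel_actl_ok. Qed.
Lemma rel_actrD X : {morph rel_actr^~ X : x y / x + y}.
Proof. exact/zmod_morphD/rel_lift_additive/rel_actr_ok. Qed.
Let rel_actl0 X : rel_actl X 0 = 0.
Proof. by apply: (addIr (rel_actl X 0)); rewrite -rel_actlD !add0r. Qed.
Let rel_actr0 X : rel_actr 0 X = 0.
Proof. by apply: (addIr (rel_actr 0 X)); rewrite -rel_actrD !add0r. Qed.

Fact rel_actlZ f X w : rel_actl X (f *: w) = f *: rel_actl X w + anchor E X f *: w.
Proof.
elim/rel_ind: w => [|x y hx hy|Y Z].
- by rewrite !(scaler0, rel_actl0, addr0).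
- by rewrite scalerDr !rel_actlD hx hy; lmod_ring.
rewrite -rel_pairZl !rel_actlE lbrZr.
by rewrite !(rel_pairDl, rel_pairDr, rel_pairZl, rel_pairZr); lmod_ring.
Qed.

Fact rel_leibniz_module :
  @is_leibniz_module R (restr eta E : lmodType R) (restr eta rel_mod : lmodType R)
    (@lbr R A eta E) rel_actl rel_actr.
Proof.
have rl r X w : rel_actl X (eta r *: w) = eta r *: rel_actl X w.
  by rewrite rel_actlZ der_eta scale0r addr0.
have rr r X w : rel_actr (eta r *: w) X = eta r *: rel_actr w X.
  elim/rel_ind: w => [|x y hx hy|Y Z]; first by rewrite !(scaler0, rel_actr0).
    by rewrite scalerDr !rel_actrD hx hy scalerDr.
  rewrite -rel_pairZl !rel_actrE /sbr lbrRl lbrRr -scalerDr rel_pairZl.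
  by rewrite scalerN.
split.
- split=> [w|X] a u v.
    change (rel_actl (eta a *: u + v) w = eta a *: rel_actl u w + rel_actl v w).
    elim/rel_ind: w => [|x y hx hy|Y Z]; first by rewrite !rel_actl0 scaler0 addr0.
      by rewrite !rel_actlD hx hy; lmod_ring.
    rewrite !rel_actlE !lbrDl !lbrRl.
    by rewrite !(rel_pairDl, rel_pairDr, rel_pairZl, rel_pairZr); lmod_ring.
  change (rel_actl X (eta a *: u + v) = eta a *: rel_actl X u + rel_actl X v).
  by rewrite rel_actlD rl.
- split=> [X|w] a u v.
    change (rel_actr (eta a *: u + v) X = eta a *: rel_actr u X + rel_actr v X).
    by rewrite rel_actrD rr.
  change (rel_actr w (eta a *: u + v) = eta a *: rel_actr w u + rel_actr w v).
  elim/rel_ind: w => [|x y hx hy|Y Z]; first by rewrite !rel_actr0 scaler0 addr0.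
    by rewrite !rel_actrD hx hy; lmod_ring.
  by rewrite !rel_actrE rel_pairDr rel_pairZr; lmod_ring.
- move=> X Y w; change (rel_actr w (lbr X Y : E) =
    rel_actr (rel_actr w X) Y + rel_actl X (rel_actr w Y)).
  have NE u Z : rel_actr (- u) Z = - rel_actr u Z.
    by apply: (addIr (rel_actr u Z)); rewrite -rel_actrD !addNr rel_actr0.
  have NL u Z : rel_actl Z (- u) = - rel_actl Z u.
    by apply: (addIr (rel_actl Z u)); rewrite -rel_actlD !addNr rel_actl0.
  elim/rel_ind: w => [|x y hx hy|Y1 Y2].
  + by rewrite !rel_actr0 rel_actl0 addr0.
  + by rewrite !rel_actrD hx hy rel_actlD; lmod_ring.
  rewrite !rel_actrE NE NL rel_actrE rel_actlE (sbrC _ X) sbr_sbr0; lmod_ring.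
- move=> X Y w; change (rel_actr w (lbr X Y : E) =
    rel_actl X (rel_actr w Y) - rel_actr (rel_actl X w) Y).
  have NL u Z : rel_actl Z (- u) = - rel_actl Z u.
    by apply: (addIr (rel_actl Z u)); rewrite -rel_actlD !addNr rel_actl0.
  elim/rel_ind: w => [|x y hx hy|Y1 Y2].
  + by rewrite !(rel_actr0, rel_actl0) subr0.
  + by rewrite !(rel_actrD, rel_actlD) hx hy; lmod_ring.
  rewrite !rel_actrE NL !rel_actlE rel_actrD !rel_actrE lbr_sbr rel_pairDl.
  lmod_ring.
move=> X Y w; change (rel_actl (lbr X Y : E) w =
  rel_actl X (rel_actl Y w) - rel_actl Y (rel_actl X w)).
elim/rel_ind: w => [|x y hx hy|Y1 Y2].
- by rewrite !rel_actl0 subr0.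
- by rewrite !rel_actlD hx hy; lmod_ring.
rewrite !rel_actlE !rel_actlD !rel_actlE (lbrA X Y Y1) (lbrA X Y Y2).
by rewrite !(rel_pairDl, rel_pairDr); lmod_ring.
Qed.

Definition rel_lp_module : lp_module E :=
  @LpModule R A eta E rel_mod rel_actl rel_actr rel_leibniz_module rel_actlZ.

Fact rel_pairing_actl X Y Z : rel_actl X (rel_pair Y Z) =
  rel_pair (lbr X Y) Z + rel_pair Y (lbr X Z).
Proof. exact: rel_actlE. Qed.
Fact rel_pairing_actr X Y Z :
  - rel_actr (rel_pair Y Z) X = rel_pair (lbr Y Z + lbr Z Y) X.
Proof. by rewrite rel_actrE opprK. Qed.

Definition assoc_pre_courant : pre_courant eta :=
  @PreCourant R A eta E rel_lp_module rel_pair rel_pair_bilin rel_pairC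
    rel_pairing_actl rel_pairing_actr rel_pair_inv.

(* $\mathcal{C}(\mathcal{E})$ *)
Definition assoc_courant : courant eta :=
  @Courant R A eta assoc_pre_courant (slp_sym E).
End Associated.

(* Main.v *)
From HB Require Import structures.
Require Import Defs.
From mathcomp Require Import all_boot all_algebra.
From mathcomp Require Import boolp.
Import GRing.Theory.
Local Open Scope ring_scope.

(** The construction is a composite of three universal ones, and so is the
    proof.

    A generalized Courant pseudoalgebra has a symmetric Leibniz pseudoalgebra
    [pc_E1 C] as its first component.  An anchored map [phi] from [M] to it
    extends to the tensor module by sending an iterated bracket of generators
    to the same iterated bracket of their images ([free_lift]).  The inductive
    formulas for the [A]-action and the anchor on the tensor module are what
    the axioms of a Leibniz pseudoalgebra force, so this extension is a morphism
    of Leibniz pseudoalgebras.  A symmetric target satisfies the relations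
    divided out in [free_slp], so the extension descends to the quotient
    ([sym_lift]).

    For the second component the compatibility with the pairings leaves only
    one choice: the class of $X\odot Y$ must go to the pairing of the images of
    [X] and [Y].  This is well defined ([assoc_lift_ok]) because the relations
    that define $\mathcal{R}$ are exactly the invariance axiom [pairing_inv],
    and it intertwines the two actions because [pairing_actl] and
    [pairing_actr] express the actions on pairings through the bracket alone.

    Uniqueness holds because both components of the source are generated: the
    first by [M] under sums and brackets ([free_slp_hom_eq]), the second by
    pairings ([assoc_courant_hom_eq]).  Since uniqueness is equality of
    records that carry proofs, it also uses proof irrelevance, through the
    extensionality lemmas. *)

Set Implicit Arguments.
Unset Strict Implicit.
Unset Printing Implicit Defensive.

(** The structure attached to a linear function consists of propositions only,
    so proof irrelevance removes it. *)
Lemma linear_map_ext (K : pzRingType) (U V : lmodType K) (f g : {linear U -> V}) :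
  f =1 g -> f = g.
Proof.
case: f => f [[f1] [f2]]; case: g => g [[g1] [g2]] /= e.
have {}e : f = g by exact: funext.
case: _ / e in g1 g2 *.
by rewrite (Prop_irrelevance f1 g1) (Prop_irrelevance f2 g2).
Qed.

Section Morphisms.
Context (R A : comPzRingType) (eta : {rmorphism R -> A}).

Lemma lp_hom_ext (E F : leibniz_pseudo eta) (f g : lp_hom E F) : f =1 g -> f = g.
Proof.
case: f => [[f fa] fb]; case: g => [[g ga] gb] /= e.
have {}e : f = g by exact: linear_map_ext.
case: _ / e in ga gb *.
case: _ / (Prop_irrelevance fa ga) in gb *.
by congr LpHom; exact: Prop_irrelevance.
Qed.

Lemma courant_hom_ext (C C' : pre_courant eta) (f g : courant_hom C C') :
  mh1 f =1 mh1 g -> mh2 f =1 mh2 g -> f = g.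
Proof.
case: f => [[f1 f2 fl fr] fp]; case: g => [[g1 g2 gl gr] gp] /= e1 e2.
have {}e1 : f1 = g1 by exact: lp_hom_ext.
have {}e2 : f2 = g2 by exact: linear_map_ext.
case: _ / e1 in gl gr gp *; case: _ / e2 in gl gr gp *.
case: _ / (Prop_irrelevance fl gl) in gp *.
case: _ / (Prop_irrelevance fr gr) in gp *.
by congr CourantHom; exact: Prop_irrelevance.
Qed.

Lemma lp_hom_sbr (E F : leibniz_pseudo eta) (h : lp_hom E F) (X Y : E) :
  h (sbr X Y) = sbr (h X) (h Y).
Proof. by rewrite raddfD /= !lh_br. Qed.
End Morphisms.

Section FreeLift.
Context (R A : comPzRingType) (eta : {rmorphism R -> A}).
Context (M : anchored eta) (E : leibniz_pseudo eta) (phi : anchored_hom M E).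

(** As $m\otimes x=[m,x]$ in the free Leibniz algebra, a bracket-preserving
    extension of [phi] has to satisfy this recursion. *)
Definition free_lift : free_lp M -> E :=
  trec (Z := restr eta E) phi (fun m z => lbr (phi m) z).

(* The bracket of [E] is bilinear over [R] on all of [E], so the invariant that
   the recursion carries along can be trivial. *)
Lemma free_lift_ok : trec_ok (M := M) (Z := restr eta E) phi
  (fun m z => lbr (phi m) z) (fun=> True).
Proof.
split=> //.
- by move=> a m m'; exact: (linearP phi).
- by move=> m a x y _ _; exact: (lbr_leibniz E).1.2.
move=> z _ a m m'.
change (lbr (phi (eta a *: m + m')) z = eta a *: lbr (phi m) z + lbr (phi m') z).
by rewrite linearP lbrDl lbrRl.
Qed.

Lemma free_lift_incl m : free_lift (tincl m) = phi m.
Proof. exact: (trec_incl free_lift_ok). Qed.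
Lemma free_lift_cons m x : free_lift (tcons m x) = lbr (phi m) (free_lift x).
Proof. exact: (trec_cons free_lift_ok). Qed.
Lemma free_liftD : {morph free_lift : x y / x + y}.
Proof. exact: (linD (trec_lin free_lift_ok)). Qed.
Lemma free_liftB : {morph free_lift : x y / x - y}.
Proof. exact: (linB (trec_lin free_lift_ok)). Qed.

(** The action rule $f(m\otimes x)=m\otimes fx-a(m)(f)x$ becomes the Leibniz
    rule $[X,fY]=f[X,Y]+a(X)(f)Y$ of [E] solved for $f[X,Y]$. *)
Lemma free_lift_act f x : free_lift (tact f x) = f *: free_lift x.
Proof.
elim/tfree_ind: x f => [x y hx hy|m|m x hx] f.
- by rewrite tactDr !free_liftD hx hy scalerDr.
- by rewrite tact_incl !free_lift_incl linearZ.
by rewrite tact_cons free_liftB !free_lift_cons !hx lbrZr ah_anchor addrK.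
Qed.

Lemma free_lift_linear : linear free_lift.
Proof. by move=> f x y; rewrite -free_lift_act -free_liftD. Qed.
HB.instance Definition _ :=
  GRing.isLinear.Build A (free_lp M) E *:%R free_lift free_lift_linear.

Lemma free_lift_anchor x : anchor E (free_lift x) = anchor (free_lp M) x.
Proof.
change (anchor E (free_lift x) = tanch x).
elim/tfree_ind: x => [x y hx hy|m|m x hx].
- by rewrite free_liftD raddfD /= hx hy tanchD.
- by rewrite free_lift_incl tanch_incl ah_anchor.
by rewrite free_lift_cons anchor_lbr hx ah_anchor tanch_cons.
Qed.

(** On $m\otimes x$ the universal bracket is $m\otimes[x,y]-[x,m\otimes y]$,
    and the Leibniz identity in [E] gives the image of the left-hand side the
    same form. *)
Lemma free_lift_br x y : free_lift (lbr x y) = lbr (free_lift x) (free_lift y).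
Proof.
change (free_lift (tbr x y) = lbr (free_lift x) (free_lift y)).
elim/tfree_ind: x y => [x x' hx hx'|m|m x hx] y.
- by rewrite (linD (tbr_linl _)) !free_liftD hx hx' lbrDl.
- by rewrite tbr_incl free_lift_cons free_lift_incl.
rewrite tbr_cons free_liftB !free_lift_cons !hx free_lift_cons lbrA.
by rewrite addrK.
Qed.

Definition free_lift_hom : lp_hom (free_lp M) E :=
  LpHom (lh_ah := AnchoredHom free_lift_anchor) free_lift_br.
End FreeLift.

Section SymLift.
Context (R A : comPzRingType) (eta : {rmorphism R -> A}).
Context (E : leibniz_pseudo eta) (F : sym_leibniz_pseudo eta) (h : lp_hom E F).
Local Notation q := (@symq_class R A eta E).

Definition sym_lift : symq_slp E -> F := lquot_lift h.

(** The two generating relations of the symmetric quotient go to the two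
    symmetry axioms of [F]. *)
Lemma lp_hom_sym_rel X : lspan (@sym_rel R A eta E) X -> h X = 0.
Proof.
elim=> [|k x y Sx _ ih]; first exact: raddf0.
rewrite linearP ih addr0; suff -> : h x = 0 by rewrite scaler0.
case: Sx => [f u v|f u v w].
  rewrite raddfB /= !lp_hom_sbr !linearZ.
  exact: (slp_sym F).1.
rewrite !raddfB /= !lh_br !lp_hom_sbr !lh_br !linearZ.
exact: (slp_sym F).2.
Qed.

Lemma sym_liftE X : sym_lift (q X) = h X.
Proof. exact: (lquot_liftE (raddfB h) lp_hom_sym_rel). Qed.

Lemma sym_lift_linear : linear sym_lift.
Proof.
move=> f; elim/lq_ind => X; elim/lq_ind => Y.
change (sym_lift (f *: q X + q Y) = f *: sym_lift (q X) + sym_lift (q Y)).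
by rewrite -linearP !sym_liftE linearP.
Qed.
HB.instance Definition _ :=
  GRing.isLinear.Build A (symq_slp E) F *:%R sym_lift sym_lift_linear.

Lemma sym_lift_anchor X : anchor F (sym_lift X) = anchor (symq_slp E) X.
Proof.
elim/lq_ind: X => X; change (anchor F (sym_lift (q X)) = symq_anchor (q X)).
by rewrite sym_liftE ah_anchor symq_anchorE.
Qed.

Lemma sym_lift_br X Y : sym_lift (lbr X Y) = lbr (sym_lift X) (sym_lift Y).
Proof.
elim/lq_ind: X => X; elim/lq_ind: Y => Y.
change (sym_lift (symq_br (q X) (q Y)) = lbr (sym_lift (q X)) (sym_lift (q Y))).
by rewrite symq_brE !sym_liftE lh_br.
Qed.

Definition sym_lift_hom : lp_hom (symq_slp E) F :=
  LpHom (lh_ah := AnchoredHom sym_lift_anchor) sym_lift_br.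
End SymLift.

Section FreeSymUnique.
Context (R A : comPzRingType) (eta : {rmorphism R -> A}).
Context (M : anchored eta) (E : leibniz_pseudo eta).

(** Every element is a sum of iterated brackets $[m_1,[m_2,\ldots]]$ of
    generators, and a morphism commutes with sums and brackets. *)
Lemma free_slp_hom_eq (f g : lp_hom (free_slp M) E) :
  (forall m, f (free_slp_incl M m) = g (free_slp_incl M m)) -> f =1 g.
Proof.
move=> e; elim/lq_ind.
change (forall x : free_lp M, f (symq_class x) = g (symq_class x)).
elim/tfree_ind => [x y hx hy|m|m x hx].
- by rewrite !raddfD /= hx hy.
- exact: e.
have -> : symq_class (tcons m x : free_lp M) =
    lbr (free_slp_incl M m) (symq_class (x : free_lp M)).
  by rewrite -tbr_incl [RHS]symq_brE.
by rewrite !lh_br e hx.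
Qed.
End FreeSymUnique.

Section AssocLift.
Context (R A : comPzRingType) (eta : {rmorphism R -> A}).
Context (E : sym_leibniz_pseudo eta) (C : pre_courant eta).
Context (h : lp_hom E (pc_E1 C)).
Implicit Types X Y Z : E.
Local Notation b X Y := (pairing (h X) (h Y)).

(** The relations of $\mathcal{R}(\mathcal{E})$ are the invariance of the pairing,
    which [C] satisfies; the scalar [f] comes out by bilinearity. *)
Lemma assoc_lift_ok : rel_ok (fun X Y => b X Y).
Proof.
have [bl br] := @pairing_bilin _ _ _ C.
have Zl f (u v : pc_E1 C) : pairing (f *: u) v = f *: pairing u v := linZ (bl v) f u.
have Zr f (u v : pc_E1 C) : pairing u (f *: v) = f *: pairing u v := linZ (br u) f v.
split.
- split=> [X X' Y|X Y Y'|f X Y].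
  + by rewrite raddfD /= (linD (bl _)).
  + by rewrite raddfD /= (linD (br _)).
  by rewrite !linearZ Zl Zr.
- by move=> X Y; exact: pairing_sym.
move=> f X Y W; rewrite !linearZ !Zl -scalerDr; congr (_ *: _).
by rewrite raddfD /= !lh_br pairing_inv pairing_sym.
Qed.

Definition assoc_lift : rel_mod E -> pc_E2 C := rel_lift (fun X Y => b X Y).

Lemma assoc_liftE X Y : assoc_lift (rel_pair X Y) = b X Y.
Proof. exact: (rel_liftE assoc_lift_ok). Qed.

Lemma assoc_lift_linear : linear assoc_lift.
Proof.
have hB : zmod_morphism assoc_lift := rel_lift_additive assoc_lift_ok.
have hD := zmod_morphD hB; have h0 := zmod_morph0 hB.
apply: lin_intro => // f; elim/rel_ind => [|x y hx hy|X Y].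
- by rewrite scaler0 h0 scaler0.
- by rewrite scalerDr !hD hx hy scalerDr.
rewrite -rel_pairZl !assoc_liftE linearZ.
exact: (linZ ((@pairing_bilin _ _ _ C).1 _)).
Qed.
HB.instance Definition _ :=
  GRing.isLinear.Build A (rel_lp_module E) (pc_E2 C) *:%R assoc_lift assoc_lift_linear.

(** On the generators of $\mathcal{R}(\mathcal{E})$ both actions are written with
    the bracket, by the formulas that hold for the pairing of any
    pre-Courant pseudoalgebra; [h] preserves the bracket. *)
Lemma assoc_lift_actl X (w : rel_lp_module E) :
  actl (h X) (assoc_lift w) = assoc_lift (actl X w).
Proof.
have [[_ al] _ _ _ _] := act_leibniz (pc_E2 C).
change (actl (h X) (assoc_lift w) = assoc_lift (rel_actl X w)).
elim/rel_ind: w => [|x y hx hy|Y Z].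
- have -> : rel_actl X 0 = 0 by apply: (addIr (rel_actl X 0)); rewrite -rel_actlD !add0r.
  by rewrite raddf0; exact: (lin0 (al _)).
- by rewrite rel_actlD !raddfD /= -hx -hy; exact: (linD (al _)).
by rewrite rel_actlE raddfD /= !assoc_liftE pairing_actl !lh_br.
Qed.

Lemma assoc_lift_actr (w : rel_lp_module E) X :
  actr (assoc_lift w) (h X) = assoc_lift (actr w X).
Proof.
have [_ [ar _] _ _ _] := act_leibniz (pc_E2 C).
change (actr (assoc_lift w) (h X) = assoc_lift (rel_actr w X)).
elim/rel_ind: w => [|x y hx hy|Y Z].
- have -> : rel_actr 0 X = 0 by apply: (addIr (rel_actr 0 X)); rewrite -rel_actrD !add0r.
  by rewrite raddf0; exact: (lin0 (ar _)).
- by rewrite rel_actrD !raddfD /= -hx -hy; exact: (linD (ar _)).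
rewrite rel_actrE raddfN /= !assoc_liftE raddfD /= !lh_br -pairing_actr.
by rewrite opprK.
Qed.

Definition assoc_lift_hom : courant_hom (assoc_courant E) C :=
  @CourantHom R A eta (assoc_courant E) C
    (@LpModuleHom R A eta E (pc_E1 C) (rel_lp_module E) (pc_E2 C) h assoc_lift
      assoc_lift_actl assoc_lift_actr)
    (fun X Y => esym (assoc_liftE X Y)).
End AssocLift.

(** The classes of $X\odot Y$ generate $\mathcal{R}(\mathcal{E})$, and the first
    component of a morphism determines the images of these classes. *)
Lemma assoc_courant_hom_eq (R A : comPzRingType) (eta : {rmorphism R -> A})
    (E : sym_leibniz_pseudo eta) (C : pre_courant eta)
    (F G : courant_hom (assoc_courant E) C) : mh1 F =1 mh1 G -> F = G.
Proof.
move=> e; apply: courant_hom_ext => //; elim/rel_ind => [|x y hx hy|X Y].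
- by rewrite !raddf0.
- by rewrite !raddfD /= hx hy.
by have := ch_pairing F X Y; rewrite !e (ch_pairing G X Y).
Qed.

Theorem theorem3 (R A : comPzRingType) (eta : {rmorphism R -> A})
    (M : anchored eta) (C : courant eta) (phi : anchored_hom M (pc_E1 C)) :
  exists! Phi : courant_hom (assoc_courant (free_slp M)) C,
    forall m : M, mh1 Phi (free_slp_incl M m) = phi m.
Proof.
pose E1 : sym_leibniz_pseudo eta := SymLeibnizPseudo (gc_sym C).
pose Phi1 : lp_hom (free_slp M) E1 := sym_lift_hom (F := E1) (free_lift_hom phi).
exists (assoc_lift_hom Phi1); split=> [m|Psi hPsi].
  by rewrite [LHS]sym_liftE; exact: free_lift_incl.
apply/assoc_courant_hom_eq/free_slp_hom_eq => m; rewrite hPsi.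
by rewrite [LHS]sym_liftE; exact: free_lift_incl.
Qed.
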